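(* Assume the following conjecture (BC) holds. (BC): for every positive integer $m$ and every non-zero polynomial $h\in\mathbb{Q}[x_3,x_5,\ldots,x_{2m+1}]$ that is homogeneous with respect to the grading $\deg(x_{2k+1})=2k+1$, there exist infinitely many primes $p$ such that $p$ does not divide the numerator of $h(B_{p-3},B_{p-5},\ldots,B_{p-2m-1})$, where $B_i$ denotes the $i$-th Bernoulli number. Then the kernel of the map $\hat{Z}:\hat{\Lambda}\to\hat{\mathcal{A}}$ is equal to the closure in $\hat{\Lambda}$ of the ideal $$I_\beta:=(\beta_0,\beta_1,\ldots)\subset\hat{\Lambda},\qquad\text{where}\qquad \beta_k:=e_k+\sum_{j=k}^{\infty}(-1)^{j+1}\binom{j}{k}e_j\in\hat{\Lambda}\quad (k\geq 0).$$
   Context: $\Lambda=\Lambda_{\mathbb{Q}}$ is the ring of symmetric functions over $\mathbb{Q}$: formal power series of bounded degree in countably many variables with rational coefficients, invariant under all permutations of the variables. $e_k$ is the $k$-th elementary symmetric function ($e_0=1$); $\Lambda$ is the free commutative $\mathbb{Q}$-algebra on $e_1,e_2,\ldots$. A symmetric function is evaluated at a finite list of rationals by setting the remaining variables to $0$. The grading by $H$-degree on $\Lambda$ is the multiplicative grading in which $e_k$ (for $k\geq 1$) is homogeneous of $H$-degree $k+1$ (constants have $H$-degree $0$). For $f=\sum_m f_m$ with $f_m$ homogeneous of $H$-degree $m$, put $v(f):=\inf\{m: f_m\neq 0\}\in\mathbb{Z}_{\geq 0}\cup\{\infty\}$, and define the ideal $\mathcal{I}_n:=\{f\in\Lambda: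 v(f)\geq n\}$. The completion is $\hat{\Lambda}:=\varprojlim_n\Lambda/\mathcal{I}_n$; its elements are formal infinite sums $\sum_{m\ge 0} f_m$ with $f_m\in\Lambda$ homogeneous of $H$-degree $m$. For $n\geq 1$ let $\mathcal{A}_n:=\left(\prod_p\mathbb{Z}/p^n\mathbb{Z}\right)/\left(\bigoplus_p\mathbb{Z}/p^n\mathbb{Z}\right)$, with $p$ ranging over all primes; an element is given by residue classes $a_p\in\mathbb{Z}/p^n\mathbb{Z}$ for all but finitely many $p$, two families being identified if they agree for all but finitely many $p$. For $f\in\Lambda$ and all sufficiently large primes $p$, $f(p/1,p/2,\ldots,p/(p-1))\in\mathbb{Z}_{(p)}$; reducing modulo $p^n$ gives a ring homomorphism $Z^{[n]}:\Lambda\to\mathcal{A}_n$. It is known that $Z^{[n]}$ vanishes on $\mathcal{I}_n$ (since $e_k(p/1,\ldots,p/(p-1))\equiv 0 \bmod p^{k+1}$ for each fixed $k\geq 1$ and all large $p$), so it induces $\tilde{Z}^{[n]}:\Lambda/\mathcal{I}_n\to\mathcal{A}_n$. These maps are compatible with the quotient maps as $n$ varies, and $\hat{Z}:\hat{\Lambda}\to\hat{\mathcal{A}}:=\varprojlim_n\mathcal{A}_n$ is the induced map on projective limits. Each $\mathcal{A}_n$ and $\Lambda/\mathcal{I}_n$ has the discrete topology, and $\hat{\mathcal{A}}$ and $\hat{\Lambda}$ have the projective limit topologies. Concretely, $\sum_m f_m\in\ker\hat{Z}$ if and only if for every $N\geq 0$ the congruence $\sum_{m<N}f_m(p/1,\ldots,p/(p-1))\equiv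 0\bmod p^N$ (in $\mathbb{Z}_{(p)}$) holds for all sufficiently large primes $p$. The numerator of a rational number refers to its expression in lowest terms. *)

(* Defs.v *)
From HB Require Import structures.
From mathcomp Require Import all_boot all_order all_algebra.
From mathcomp Require Import generic_quotient ring_quotient.
From mathcomp Require mpoly.

Set Implicit Arguments.
Unset Strict Implicit.
Unset Printing Implicit Defensive.

Import Order.TTheory GRing.Theory Num.Theory.
Local Open Scope ring_scope.

Definition next_bernoulli (s : seq rat) : rat :=
  ((size s == 0%N)%:R - \sum_(k < size s) 'C((size s).+1, k)%:R * s`_k)
  / (size s).+1%:R.

Definition bernoulli_seq (n : nat) : seq rat :=
  iter n (fun s => rcons s (next_bernoulli s)) [::].

Definition bernoulli (n : nat) : rat := (bernoulli_seq n.+1)`_n.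

Lemma size_bernoulli_seq n : size (bernoulli_seq n) = n.
Proof. by elim: n => //= n IH; rewrite size_rcons IH. Qed.

Lemma nth_bernoulli_seq n k : (k < n)%N -> (bernoulli_seq n)`_k = bernoulli k.
Proof.
elim: n => // n IH; rewrite ltnS leq_eqVlt => /predU1P[-> //|kn].
by rewrite /= nth_rcons size_bernoulli_seq kn IH.
Qed.

(* This is the convention B_1 = -1/2; for p large only B_i with i even occur. *)
Lemma bernoulli_rec n :
  \sum_(k < n.+1) 'C(n.+1, k)%:R * bernoulli k = (n == 0%N)%:R.
Proof.
rewrite big_ord_recr /= binSn {2}/bernoulli /= nth_rcons size_bernoulli_seq.
rewrite ltnn eqxx /next_bernoulli size_bernoulli_seq mulrC divfK ?pnatr_eq0 //.
under [X in _ - X]eq_bigr => k _ do rewrite nth_bernoulli_seq //.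
by rewrite addrC subrK.
Qed.

(* In a module, because the notations of mpoly clash with those of monalg. *)
Module Export BernoulliConjecture.
Import mpoly.

(* The variable 'X_i, for 0 <= i < m, stands for x_(2i+3), of degree 2i+3. *)
Definition odd_whomog (m d : nat) (h : {mpoly rat[m]}) : Prop :=
  forall a : 'X_{1..m}, a \in msupp h -> (\sum_(i < m) a i * (2 * i + 3))%N = d.

(* Only large primes matter, so the truncation of p - (2i+3) is harmless. *)
Definition bernoulli_conjecture : Prop :=
  forall (m : nat) (h : {mpoly rat[m]}), (0 < m)%N -> h != 0 ->
    (exists d, odd_whomog d h) ->
    forall N : nat, exists p : nat, [/\ prime p, (N < p)%N &
      ~~ (p%:Z %| numq h.@[fun i : 'I_m => bernoulli (p - (2 * i + 3))])%Z].

End BernoulliConjecture.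

From mathcomp Require Import finmap monalg.
From mathcomp Require Import all_classical topology.

Local Open Scope classical_set_scope.
Local Open Scope ring_scope.
Local Notation "1" := (@mone _) : monom_scope.
Local Notation "x * y" := (mmul x y) : monom_scope.

Section MonomialFactorisations.
Implicit Types a b m : {cmonom nat}.

Definition subcm m (h : {ffun finsupp m -> 'I_(mdeg m).+1}) : {cmonom nat} :=
  [cmonom nat_of_ord (h i) | i : finsupp m]%M.

(* The finitely many pairs (a, b) of monomials with a * b = m. *)
Definition decs m : seq ({cmonom nat} * {cmonom nat}) :=
  undup [seq x : {cmonom nat} * {cmonom nat} <-
           [seq (subcm h, divcm m (subcm h)) |
              h : {ffun finsupp m -> 'I_(mdeg m).+1}]
         | (x.1 * x.2)%M == m].

Lemma decs_uniq m : uniq (decs m).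
Proof. exact: undup_uniq. Qed.

Lemma cm_le_mdeg m i : (m i <= mdeg m)%N.
Proof.
rewrite mdegE; case: (mdomP m i) => // iS.
by rewrite (big_fsetD1 i) //= leq_addr.
Qed.

Lemma mem_decs m x : (x \in decs m) = ((x.1 * x.2)%M == m).
Proof.
case: x => a b; rewrite mem_undup mem_filter /=.
case: eqP => //= mE; apply/mapP.
exists [ffun i : finsupp m => inord (a (val i))]; first by rewrite mem_enum.
suff aE : subcm [ffun i : finsupp m => inord (a (val i))] = a.
  rewrite aE; congr pair; apply/eqP/cmP => i.
  by rewrite divcmE -mE cmM addKn.
apply/eqP/cmP => i; rewrite cmE fsfun_ffun.
case: insubP => [[j jS] _ /= <-|].
  rewrite ffunE inordK //= ltnS -mE mdegM.
  by apply: leq_trans (cm_le_mdeg a j) (leq_addr _ _).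
by rewrite -cmE_neq0 negbK -mE cmM addn_eq0 => /andP[/eqP-> _].
Qed.

(* b is the monomial obtained from a by permuting the variables along s. *)
Lemma finsupp_permute (s : nat -> nat) a b : bijective s ->
  (forall i, b i = a (s i)) -> perm_eq (finsupp a) [seq s i | i <- finsupp b].
Proof.
move=> s_bij bE; have s_inj := bij_inj s_bij.
apply: uniq_perm; rewrite ?map_inj_uniq ?fset_uniq // => j.
have [t ts st] := s_bij.
apply/idP/mapP => [jS|[i iS ->]].
  by exists (t j); rewrite ?st // -cmE_neq0 bE st cmE_neq0.
by rewrite -cmE_neq0 -bE cmE_neq0.
Qed.

Lemma mdeg_permute (s : nat -> nat) a b : bijective s ->
  (forall i, b i = a (s i)) -> mdeg b = mdeg a.
Proof.
move=> s_bij bE; rewrite !mdegE (perm_big _ (finsupp_permute s_bij bE)) /=.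
by rewrite big_map; apply: eq_bigr => i _; rewrite bE.
Qed.

Lemma exists_permute (s : nat -> nat) : bijective s ->
  {f : {cmonom nat} -> {cmonom nat} | forall a i, f a i = a (s i)}.
Proof.
move=> s_bij; apply: cid; have [t ts st] := s_bij.
exists (fun a => [cmonom a (s i) | i in [fset t j | j in finsupp a]%fset]%M).
move=> a i; rewrite cmE fsfun_fun; case: ifP => // /negbT/imfsetP iN.
apply/esym/eqP; rewrite cmE_eq0; apply/negP => siS; apply: iN.
by exists (s i) => //; rewrite ts.
Qed.

End MonomialFactorisations.

(* Formal power series in the variables x_0, x_1, ..., as coefficient
   functions on monomials. *)
Definition powser := {cmonom nat} -> rat.

Section PowserRing.
Implicit Types f g h : powser.

HB.instance Definition _ := GRing.Zmodule.copy powser ({cmonom nat} -> rat).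

Definition onep : powser := fun m => (m == 1%M)%:R.

Definition mulp f g : powser := fun m =>
  \sum_(x \in [set x : {cmonom nat} * {cmonom nat} | (x.1 * x.2)%M = m])
     f x.1 * g x.2.

Definition scalep (c : rat) f : powser := fun m => c * f m.

Lemma mulpE f g m : mulp f g m = \sum_(x <- decs m) f x.1 * g x.2.
Proof.
rewrite (fsbig_seq _ _ (decs_uniq m)); apply: eq_fsbigl.
apply/seteqP; split => x /=; rewrite mem_decs; first by move=> ->.
by move/eqP.
Qed.

Lemma addpE f g m : (f + g) m = f m + g m.
Proof. by []. Qed.

Fact mulpC : commutative mulp.
Proof.
move=> f g; apply/funext => m; rewrite !mulpE.
have P : perm_eq (decs m) [seq (x.2, x.1) | x <- decs m].
  apply: uniq_perm; rewrite ?map_inj_uniq ?decs_uniq //.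
    by move=> [a b] [c d] [-> ->].
  move=> [a b]; apply/idP/mapP => [abm|[[c d] cdm [-> ->]]].
    by exists (b, a); rewrite // mem_decs /= mulmC -(mem_decs m (a, b)).
  by rewrite mem_decs /= mulmC -(mem_decs m (c, d)).
by rewrite (perm_big _ P) big_map; apply: eq_bigr => x _; rewrite mulrC.
Qed.

Fact mulpA : associative mulp.
Proof.
move=> f g h; apply/funext => m; rewrite !mulpE.
under eq_bigr => x _ do rewrite mulpE big_distrr /=.
under [RHS]eq_bigr => x _ do rewrite mulpE big_distrl /=.
pose T := ({cmonom nat} * ({cmonom nat} * {cmonom nat}))%type.
pose F (t : T) := f t.1 * (g t.2.1 * h t.2.2).
transitivity (\sum_(t <- [seq ((x.1, (y.1, y.2)) : T) | x <- decs m,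
     y <- decs x.2]) F t).
  by rewrite big_allpairs_dep.
transitivity (\sum_(t <- [seq ((y.1, (y.2, x.2)) : T) | x <- decs m,
     y <- decs x.1]) F t); last first.
  rewrite big_allpairs_dep; apply: eq_bigr => x _; apply: eq_bigr => y _.
  by rewrite /F /= mulrA.
apply: perm_big; apply: uniq_perm.
- apply: allpairs_uniq_dep; try by move=> *; exact: decs_uniq.
  move=> [[a b] [c d]] [[a' b'] [c' d']] /allpairsPdep[x1 [y1 [_ h1 e1]]].
  move=> /allpairsPdep[x2 [y2 [_ h2 e2]]].
  case: e1 h1 => ? ?; subst x1 y1; case: e2 h2 => ? ?; subst x2 y2.
  rewrite !mem_decs /= => /eqP <- /eqP <- [-> -> ->] //.
- apply: allpairs_uniq_dep; try by move=> *; exact: decs_uniq.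
  move=> [[a b] [c d]] [[a' b'] [c' d']] /allpairsPdep[x1 [y1 [_ h1 e1]]].
  move=> /allpairsPdep[x2 [y2 [_ h2 e2]]].
  case: e1 h1 => ? ?; subst x1 y1; case: e2 h2 => ? ?; subst x2 y2.
  rewrite !mem_decs /= => /eqP <- /eqP <- [-> -> ->] //.
move=> [a [b c]]; apply/allpairsPdep/allpairsPdep.
  move=> [x [y [+ + [-> -> ->]]]]; rewrite !mem_decs => /eqP xm /eqP yx.
  exists ((x.1 * y.1)%M, y.2), (x.1, y.1); split => //.
    by rewrite mem_decs /= -xm -yx mulmA.
  by rewrite mem_decs.
move=> [x [y [+ + [-> -> ->]]]]; rewrite !mem_decs => /eqP xm /eqP yx.
exists (y.1, (y.2 * x.2)%M), (y.2, x.2); split => //.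
  by rewrite mem_decs /= -xm -yx mulmA.
by rewrite mem_decs.
Qed.

Fact mul1p : left_id onep mulp.
Proof.
move=> f; apply/funext => m; rewrite mulpE.
rewrite (bigD1_seq (1%M, m)) ?decs_uniq ?mem_decs /= ?mul1m //.
rewrite /onep eqxx mul1r big_seq_cond big1 ?addr0 // => -[a b] /=.
rewrite mem_decs /= => /andP[/eqP <-].
by have [->|] := eqVneq a 1%M; rewrite ?mul0r // mul1m eqxx.
Qed.

Fact mulpDl : left_distributive mulp +%R.
Proof.
move=> f g h; apply/funext => m; rewrite addpE !mulpE -big_split /=.
by apply: eq_bigr => x _; rewrite addpE mulrDl.
Qed.

Fact onep_neq0 : onep != 0.
Proof. by apply/eqP => /(congr1 (@^~ 1%M)); rewrite /onep eqxx. Qed.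

HB.instance Definition _ := GRing.Zmodule_isComNzRing.Build powser
  mulpA mulpC mul1p mulpDl onep_neq0.

Fact scalepA a b f : scalep a (scalep b f) = scalep (a * b) f.
Proof. by apply/funext => m; rewrite /scalep mulrA. Qed.

Fact scale1p : left_id 1 scalep.
Proof. by move=> f; apply/funext => m; rewrite /scalep mul1r. Qed.

Fact scalepDr : right_distributive scalep +%R.
Proof. by move=> c f g; apply/funext => m; rewrite /scalep !addpE mulrDr. Qed.

Fact scalepDl f : {morph scalep^~ f : a b / a + b}.
Proof. by move=> a b; apply/funext => m; rewrite addpE /scalep mulrDl. Qed.

HB.instance Definition _ := GRing.Zmodule_isLmodule.Build rat powser
  scalepA scale1p scalepDr scalepDl.

Lemma powser_mulE f g m : (f * g) m = \sum_(x <- decs m) f x.1 * g x.2.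
Proof. exact: mulpE. Qed.

Lemma powser_scaleE (c : rat) f m : (c *: f) m = c * f m.
Proof. by []. Qed.

Lemma powser_oneE m : (1 : powser) m = (m == 1%M)%:R.
Proof. by []. Qed.

Fact scalepAl (c : rat) f g : c *: (f * g) = (c *: f) * g.
Proof.
apply/funext => m; rewrite powser_scaleE !powser_mulE big_distrr /=.
by apply: eq_bigr => x _; rewrite powser_scaleE mulrA.
Qed.

HB.instance Definition _ := GRing.Lmodule_isLalgebra.Build rat powser scalepAl.
HB.instance Definition _ := GRing.Lalgebra_isComAlgebra.Build rat powser.

End PowserRing.

Definition bounded_degree (f : powser) : Prop :=
  exists d, forall m, f m != 0 -> (mdeg m <= d)%N.

Definition perm_invariant (f : powser) : Prop :=
  forall s : nat -> nat, bijective s -> forall a b : {cmonom nat},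
    (forall i, b i = a (s i)) -> f b = f a.

Definition symmetric_ps : {pred powser} :=
  fun f => `[< bounded_degree f /\ perm_invariant f >].

Fact symmetric_ps_closed : GRing.subsemialg_closed symmetric_ps.
Proof.
split.
- apply/asboolP; split.
    by exists 0%N => m; rewrite powser_oneE; have [->|_] := eqVneq m 1%M; rewrite ?mdeg1 ?eqxx.
  move=> s sb a b bE; rewrite !powser_oneE -!mdeg_eq0.
  by rewrite (mdeg_permute sb bE).
- split.
    apply/asboolP; split; first by exists 0%N => m /eqP; case.
    by [].
  move=> f g /asboolP[[d fd] fs] /asboolP[[d' gd] gs]; apply/asboolP; split.
    exists (maxn d d') => m; rewrite addpE leq_max => fg.
    have [f0|/fd->//] := eqVneq (f m) 0.
    by rewrite gd ?orbT //; apply: contraNneq fg => ->; rewrite f0 addr0.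
  by move=> s sb a b bE; rewrite !addpE (fs s sb a b) ?(gs s sb a b).
- move=> c f /asboolP[[d fd] fs]; apply/asboolP; split.
    by exists d => m; rewrite powser_scaleE mulf_eq0 negb_or => /andP[_ /fd].
  by move=> s sb a b bE; rewrite !powser_scaleE (fs s sb a b).
- move=> f g /asboolP[[d fd] fs] /asboolP[[d' gd] gs]; apply/asboolP; split.
    exists (d + d')%N => m; rewrite powser_mulE; apply: contraNT; rewrite -ltnNge => md.
    apply/eqP; rewrite big_seq big1 // => -[a b]; rewrite mem_decs /= => /eqP mE.
    have [->|/fd la] := eqVneq (f a) 0; first by rewrite mul0r.
    have [->|/gd lb] := eqVneq (g b) 0; first by rewrite mulr0.
    by move: md; rewrite -mE mdegM ltnNge leq_add.
  move=> s sb a b bE; rewrite !powser_mulE.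
  have [r rE] := exists_permute sb.
  have rM x y : r (x * y)%M = (r x * r y)%M.
    by apply/eqP/cmP => i; rewrite rE !cmM !rE.
  have [t ts st] := sb.
  have r_inj : injective r.
    by move=> x y /eqP/cmP xy; apply/eqP/cmP => i; rewrite -[i]st -!rE xy.
  have -> : b = r a by apply/eqP/cmP => i; rewrite rE bE.
  have [r' r'E] := exists_permute (Bijective st ts).
  have r'K : cancel r' r by move=> x; apply/eqP/cmP => i; rewrite rE r'E ts.
  have P : perm_eq (decs (r a)) [seq (r x.1, r x.2) | x <- decs a].
    apply: uniq_perm; rewrite ?decs_uniq //.
      rewrite map_inj_uniq ?decs_uniq // => -[x y] [x' y'] [].
      by move=> /r_inj-> /r_inj->.
    move=> [x y]; apply/idP/mapP => [|[[x' y'] + [-> ->]]].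
      rewrite mem_decs /= => /eqP xy; exists (r' x, r' y); rewrite /= ?r'K //.
      by rewrite mem_decs /= -(inj_eq r_inj) rM !r'K xy.
    by rewrite !mem_decs /= -rM (inj_eq r_inj).
  rewrite (perm_big _ P) big_map; apply: eq_bigr => -[x y] _ /=.
  by rewrite (fs s sb x) ?(gs s sb y).
Qed.

(* The ring Lambda of symmetric functions over rat. *)
Record symfun := SymFun {
  symfun_val : powser;
  symfun_valP : symfun_val \in symmetric_ps }.

HB.instance Definition _ := [isSub for symfun_val].
HB.instance Definition _ := [Choice of symfun by <:].
HB.instance Definition _ := GRing.SubChoice_isSubAlgebra.Build rat powser
  symmetric_ps symfun symmetric_ps_closed.
HB.instance Definition _ := [SubNzRing_isSubComNzRing of symfun by <:].

(* e_k: the sum of all squarefree monomials of degree k. *)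
Definition elem_ps (k : nat) : powser := fun m =>
  ((mdeg m == k) && all (fun i => m i == 1%N) (finsupp m))%:R.

Fact elem_ps_symmetric k : elem_ps k \in symmetric_ps.
Proof.
apply/asboolP; split.
  by exists k => m; rewrite /elem_ps; have [->|_] := eqVneq (mdeg m) k; rewrite ?eqxx.
move=> s sb a b bE; rewrite /elem_ps (mdeg_permute sb bE).
rewrite (perm_all _ (finsupp_permute sb bE)) all_map.
by congr ((_ && _)%:R); apply: eq_all => i /=; rewrite bE.
Qed.

Definition elem (k : nat) : symfun := SymFun (elem_ps_symmetric k).

(* Value of a symmetric function at x_0 = s_0, ..., x_(n-1) = s_(n-1), where
   n = size s, and x_i = 0 for i >= n (nth returns 0 past the end of s).  The
   sum is finitely supported because f has bounded degree. *)
Definition seval (f : symfun) (s : seq rat) : rat :=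
  \sum_(m \in [set: {cmonom nat}]) symfun_val f m * \prod_(i <- finsupp m) s`_i ^+ m i.

Definition Hdeg (l : seq nat) : nat := (\sum_(k <- l) k.+1)%N.

(* f is homogeneous of H-degree m: it is a rational linear combination of
   products e_(l_0) * e_(l_1) * ... with all l_i >= 1 and
   (l_0 + 1) + (l_1 + 1) + ... = m. *)
Definition Hhomog (m : nat) (f : symfun) : Prop :=
  exists2 s : seq (rat * seq nat),
    all (fun x => (0%N \notin x.2) && (Hdeg x.2 == m)) s &
    f = \sum_(x <- s) x.1 *: \prod_(k <- x.2) elem k.

Lemma Hhomog0 m : Hhomog m 0.
Proof. by exists [::]; rewrite ?big_nil. Qed.

Lemma HhomogD m f g : Hhomog m f -> Hhomog m g -> Hhomog m (f + g).
Proof.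
move=> [s sP ->] [t tP ->]; exists (s ++ t); last by rewrite big_cat.
by rewrite all_cat sP.
Qed.

Lemma HhomogZ m c f : Hhomog m f -> Hhomog m (c *: f).
Proof.
move=> [s sP ->]; exists [seq (c * x.1, x.2) | x <- s].
  by rewrite all_map; apply: sub_all sP => x.
by rewrite big_map scaler_sumr; apply: eq_bigr => x _; rewrite scalerA.
Qed.

Lemma HhomogN m f : Hhomog m f -> Hhomog m (- f).
Proof. by rewrite -scaleN1r; exact: HhomogZ. Qed.

Lemma Hhomog1 : Hhomog 0 1.
Proof.
by exists [:: (1, [::])]; rewrite /= /Hdeg ?big_nil // big_seq1 big_nil scale1r.
Qed.

Lemma Hhomog_elem k : Hhomog k.+2 (elem k.+1).
Proof.
exists [:: (1, [:: k.+1])]; first by rewrite /= /Hdeg big_seq1 eqxx.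
by rewrite !big_seq1 scale1r.
Qed.

Lemma Hhomog_sum m (I : Type) (r : seq I) (P : pred I) (F : I -> symfun) :
  (forall i, P i -> Hhomog m (F i)) -> Hhomog m (\sum_(i <- r | P i) F i).
Proof.
by move=> FP; apply: big_ind FP; [exact: Hhomog0 | exact: HhomogD].
Qed.

Lemma HhomogM m n f g : Hhomog m f -> Hhomog n g -> Hhomog (m + n) (f * g).
Proof.
move=> [s sP ->] [t tP ->].
rewrite big_distrlr /= big_seq_cond; apply: Hhomog_sum => x.
rewrite andbT => /(allP sP)/andP[x0 /eqP xm].
rewrite big_seq_cond; apply: Hhomog_sum => y.
rewrite andbT => /(allP tP)/andP[y0 /eqP yn].
exists [:: (x.1 * y.1, x.2 ++ y.2)].
  by rewrite /= andbT /Hdeg big_cat mem_cat negb_or x0 y0 -xm -yn /=.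
by rewrite big_seq1 /= big_cat /= -scalerAl -scalerAr scalerA.
Qed.

(* The completion of Lambda: the formal sum of the f_m is represented by the
   sequence of its components f_m, homogeneous of H-degree m. *)
Record Lhat := MkLhat {
  comp :> nat -> symfun;
  compP : forall m, Hhomog m (comp m) }.

Lemma LhatP (f g : Lhat) : (forall m, f m = g m) -> f = g.
Proof.
case: f g => [f fP] [g gP] /= fg.
have {}fg : f = g by apply/funext.
by case: g / fg gP => gP; congr MkLhat; exact: Prop_irrelevance.
Qed.

HB.instance Definition _ := gen_eqMixin Lhat.
HB.instance Definition _ := gen_choiceMixin Lhat.

Section LhatRing.
Implicit Types f g h : Lhat.

Definition zero_hat : Lhat := @MkLhat (fun=> 0) Hhomog0.

Definition opp_hat f : Lhat :=
  @MkLhat (fun m => - f m) (fun m => HhomogN (compP f m)).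

Definition add_hat f g : Lhat :=
  @MkLhat (fun m => f m + g m) (fun m => HhomogD (compP f m) (compP g m)).

Fact one_hat_homog m : Hhomog m (if m == 0%N then 1 else 0).
Proof. by case: m => [|m]; [exact: Hhomog1 | exact: Hhomog0]. Qed.

Definition one_hat : Lhat := MkLhat one_hat_homog.

Fact mul_hat_homog f g m : Hhomog m (\sum_(i < m.+1) f i * g (m - i)%N).
Proof.
apply: Hhomog_sum => i _; rewrite -{1}(subnKC (ltn_ord i : i <= m)%N).
by apply: HhomogM; exact: compP.
Qed.

Definition mul_hat f g : Lhat := MkLhat (mul_hat_homog f g).

Fact add_hatA : associative add_hat.
Proof. by move=> f g h; apply: LhatP => m /=; rewrite addrA. Qed.

Fact add_hatC : commutative add_hat.
Proof. by move=> f g; apply: LhatP => m /=; rewrite addrC. Qed.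

Fact add_hat0 : left_id zero_hat add_hat.
Proof. by move=> f; apply: LhatP => m /=; rewrite add0r. Qed.

Fact add_hatN : left_inverse zero_hat opp_hat add_hat.
Proof. by move=> f; apply: LhatP => m /=; rewrite addNr. Qed.

HB.instance Definition _ := GRing.isZmodule.Build Lhat
  add_hatA add_hatC add_hat0 add_hatN.

Let trunc n f : {poly symfun} := \poly_(i < n.+1) f i.

Let mul_hatE n m f g : (m <= n)%N -> mul_hat f g m = (trunc n f * trunc n g)`_m.
Proof.
move=> mn; rewrite coefM /=; apply: eq_bigr => i _.
rewrite !coef_poly !ltnS (leq_trans _ mn) ?(leq_trans (leq_subr _ _) mn) //.
exact: ltn_ord i.
Qed.

Fact mul_hatC : commutative mul_hat.
Proof.
by move=> f g; apply: LhatP => m; rewrite !(@mul_hatE m) // mulrC.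
Qed.

Fact mul_hatA : associative mul_hat.
Proof.
move=> f g h; apply: LhatP => m.
transitivity ((trunc m f * (trunc m g * trunc m h))`_m).
  rewrite (@mul_hatE m) // !coefM; apply: eq_bigr => i _.
  by rewrite [in X in _ * X]coef_poly ltnS leq_subr (@mul_hatE m) ?leq_subr.
rewrite mulrA (@mul_hatE m) // !coefM; apply: eq_bigr => i _.
have im : (i <= m)%N by exact: ltn_ord i.
by congr (_ * _); rewrite coef_poly ltnS im (@mul_hatE m).
Qed.

Fact mul_hat1 : left_id one_hat mul_hat.
Proof.
move=> f; apply: LhatP => m /=; rewrite big_ord_recl /= mul1r subn0.
by rewrite big1 ?addr0 // => i _; rewrite mul0r.
Qed.

Fact mul_hatDl : left_distributive mul_hat +%R.
Proof.
move=> f g h; apply: LhatP => m /=; rewrite -big_split /=.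
by apply: eq_bigr => i _; rewrite mulrDl.
Qed.

Fact one_hat_neq0 : one_hat != 0.
Proof.
by apply/eqP => /(congr1 (fun f : Lhat => f 0%N)) /= /eqP; rewrite oner_eq0.
Qed.

HB.instance Definition _ := GRing.Zmodule_isComNzRing.Build Lhat
  mul_hatA mul_hatC mul_hat1 mul_hatDl one_hat_neq0.

End LhatRing.

(* The projective limit topology: the basic neighbourhoods of f are the
   fibres of the projections from the completion to Lambda / I_n. *)
Definition Lhat_nbhs (f : Lhat) : set_system Lhat :=
  filter_from [set: nat] (fun n => [set g : Lhat | forall m, (m < n)%N -> g m = f m]).

HB.instance Definition _ := hasNbhs.Build Lhat Lhat_nbhs.

Fact Lhat_nbhs_filter (f : Lhat) : ProperFilter (nbhs f).
Proof.
apply: filter_from_proper; last by move=> n _; exists f.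
apply: filter_from_filter; first by exists 0%N.
move=> i j _ _; exists (maxn i j) => // g gf.
by split=> m mi; apply: gf; rewrite leq_max mi ?orbT.
Qed.

Fact Lhat_nbhs_singleton (f : Lhat) (A : set Lhat) : nbhs f A -> A f.
Proof. by move=> [n _]; apply. Qed.

Fact Lhat_nbhs_nbhs (f : Lhat) (A : set Lhat) : nbhs f A -> nbhs f (nbhs^~ A).
Proof.
move=> [n _ nA]; exists n => // g gf; exists n => // h hg.
by apply: nA => m mn; rewrite hg // gf.
Qed.

HB.instance Definition _ := Nbhs_isNbhsTopological.Build Lhat
  Lhat_nbhs_filter Lhat_nbhs_singleton Lhat_nbhs_nbhs.

(* The formal sum of the c_j e_j over j >= 0; note that e_0 = 1 has H-degree 0
   whereas e_j has H-degree j + 1 for j >= 1. *)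
Definition elem_series_comp (c : nat -> rat) (m : nat) : symfun :=
  match m with
  | 0 => c 0%N *: elem 0
  | 1 => 0
  | j.+1 => c j *: elem j
  end.

Lemma elem0 : elem 0 = 1.
Proof.
apply/val_inj/funext => m; rewrite /= powser_oneE /elem_ps mdeg_eq0.
by case: eqP => //= ->; rewrite mdom1.
Qed.

Fact elem_series_homog c m : Hhomog m (elem_series_comp c m).
Proof.
case: m => [|[|j]] /=; last by apply/HhomogZ/Hhomog_elem.
  by apply: HhomogZ; rewrite elem0; exact: Hhomog1.
exact: Hhomog0.
Qed.

Definition elem_series (c : nat -> rat) : Lhat := MkLhat (elem_series_homog c).

Definition beta (k : nat) : Lhat :=
  elem_series (fun j => if j == k then 1 else 0)
  + elem_series (fun j => if (k <= j)%N then (-1) ^+ j.+1 * 'C(j, k)%:R else 0).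

Definition I_beta : set Lhat :=
  [set f | exists s : seq (Lhat * nat), f = \sum_(x <- s) x.1 * beta x.2].

(* The product over all primes p of Z / p^n; only meant for n >= 1, because
   'Z_1 is not the trivial ring. *)
Definition prodZ (n : nat) := forall p : {p : nat | prime p}, 'Z_(sval p ^ n).

Section ProdZ.
Variable n : nat.
Implicit Types a b c : prodZ n.

HB.instance Definition _ := gen_eqMixin (prodZ n).
HB.instance Definition _ := gen_choiceMixin (prodZ n).

Definition zeroZ : prodZ n := fun p => 0.
Definition oneZ : prodZ n := fun p => 1.
Definition oppZ a : prodZ n := fun p => - a p.
Definition addZ a b : prodZ n := fun p => a p + b p.
Definition mulZ a b : prodZ n := fun p => a p * b p.

Fact addZA : associative addZ.
Proof. by move=> a b c; apply/functional_extensionality_dep => p; exact: addrA. Qed.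

Fact addZC : commutative addZ.
Proof. by move=> a b; apply/functional_extensionality_dep => p; exact: addrC. Qed.

Fact addZ0 : left_id zeroZ addZ.
Proof. by move=> a; apply/functional_extensionality_dep => p; exact: add0r. Qed.

Fact addZN : left_inverse zeroZ oppZ addZ.
Proof. by move=> a; apply/functional_extensionality_dep => p; exact: addNr. Qed.

HB.instance Definition _ := GRing.isZmodule.Build (prodZ n)
  addZA addZC addZ0 addZN.

Fact mulZA : associative mulZ.
Proof. by move=> a b c; apply/functional_extensionality_dep => p; exact: mulrA. Qed.

Fact mulZC : commutative mulZ.
Proof. by move=> a b; apply/functional_extensionality_dep => p; exact: mulrC. Qed.

Fact mulZ1 : left_id oneZ mulZ.
Proof. by move=> a; apply/functional_extensionality_dep => p; exact: mul1r. Qed.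

Fact mulZDl : left_distributive mulZ +%R.
Proof. by move=> a b c; apply/functional_extensionality_dep => p; exact: mulrDl. Qed.

Fact oneZ_neq0 : oneZ != 0.
Proof.
apply/eqP => /(congr1 (fun a : prodZ n => a (exist _ 2%N isT))) /eqP.
by rewrite oner_eq0.
Qed.

HB.instance Definition _ := GRing.Zmodule_isComNzRing.Build (prodZ n)
  mulZA mulZC mulZ1 mulZDl oneZ_neq0.

(* The direct sum over all primes p of Z / p^n, as an ideal of prodZ n. *)
Definition sumZ : {pred prodZ n} := fun a => `[< finite_set [set p | a p != 0] >].

Fact sumZ_idealr_closed : idealr_closed sumZ.
Proof.
split.
- apply/asboolP; apply: sub_finite_set (finite_set0 _) => p /negP; apply.
  exact: eqxx.
- apply/asboolP => /finite_fsetP[X XE].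
  pose N := (\max_(p <- X) sval p)%N.
  have [q Nq qP] := prime_above N.
  have : [set p | (1 : prodZ n) p != 0] (exist _ q qP) by exact: oner_neq0.
  rewrite XE /= => qX; move: Nq; rewrite ltnNge => /negP; apply.
  by rewrite /N (big_fsetD1 _ qX) /= leq_maxl.
- move=> a u v /asboolP uF /asboolP vF; apply/asboolP.
  apply: (@sub_finite_set _ _ ([set p | u p != 0] `|` [set p | v p != 0])).
    move=> p /=; have [u0|] := eqVneq (u p) 0; last by left.
    move=> auv; right; apply: contraNneq auv => v0.
    have -> : (a * u + v) p = a p * u p + v p by [].
    by rewrite u0 v0 mulr0 addr0.
  by rewrite finite_setU.
Qed.

HB.instance Definition _ := isIdealr.Build (prodZ n) sumZ sumZ_idealr_closed.

End ProdZ.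

Definition calA (n : nat) := {ideal_quot (@sumZ n)}.

(* Reduction modulo N of a rational number with denominator prime to N. *)
Definition ratmod (N : nat) (q : rat) : 'Z_N := (numq q)%:~R / (denq q)%:~R.

(* The list p/1, p/2, ..., p/(p-1). *)
Definition plist (p : nat) : seq rat := [seq p%:R / i%:R | i <- iota 1 p.-1].

(* At the finitely many p for which f(p/1, ..., p/(p-1)) is not p-integral, the
   value of ratmod is meaningless but does not affect the class in calA n. *)
Definition Zfamily (n : nat) (f : symfun) : prodZ n :=
  fun p => ratmod (sval p ^ n) (seval f (plist (sval p))).

Definition Zn (n : nat) (f : symfun) : calA n := \pi_(calA n)%qT (Zfamily n f).

(* The limit of the calA n, n >= 1, is a subring of their product, where Zhat
   takes its values.  The component of index n is the one in calA n.+1, and the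
   class of f in Lambda / I_(n.+1) is that of the sum of the f m, m < n.+1. *)
Definition Zhat (f : Lhat) : forall n : nat, calA n.+1 :=
  fun n => Zn n.+1 (\sum_(m < n.+1) f m).

Definition ker_Zhat : set Lhat := [set f | forall n, Zhat f n = 0].

(* Main.v *)
(* Evaluated at p/1, ..., p/(p-1), the generating polynomial of the e_k is
   prod_i (1 + p X / i), which is invariant under X |-> -1 - X for odd p: this
   gives beta_k |-> 0.  Conversely, for odd k the leading term of beta_k is
   2 e_k, so modulo the ideal the lowest component of a kernel element is a
   polynomial in e_2, e_4, ...  By Glaisher's congruence e_k takes the value
   - p^(k+1) B_(p-1-k) / (k+1) modulo p^(k+2) for even k, hence that polynomial
   in the B_(p-3), B_(p-5), ... is divisible by every large prime p, and it
   vanishes by the conjecture. *)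
Require Import Defs.
From mathcomp Require Import all_boot all_order all_algebra.
From mathcomp Require Import ring zify.
From mathcomp Require mpoly.

Set Implicit Arguments.
Unset Strict Implicit.
Unset Printing Implicit Defensive.

Import Order.TTheory GRing.Theory Num.Theory.
Local Open Scope ring_scope.

(** The grading fits the conjecture: for even k the H-degree k + 1 of e_k is both a power of p
    dividing its value and the weight of x_(k+1), which stands for B_(p-k-1). So a form of H-degree
    n in e_2, e_4, ... takes values in p^n Z_(p), and its digit at p^n is a weighted homogeneous
    polynomial in Bernoulli numbers. Only the kernel condition at the next level, n + 1, constrains
    that digit.

    Membership in the closure asks for an approximation in each H-degree separately, so one
    component is killed at a time; the tails of the beta_k brought in by this have higher H-degree
    and are left to later stages.

    Glaisher's congruence is obtained from (X + 1) R(X + 1) = (X + p) R(X), where R = (X + 1) ... (X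
    + p - 1): comparing coefficients gives a triangular recursion for those of R.

    Congruences are between rationals with denominator prime to p, and hold beyond a bound depending
    on the finitely many rational coefficients involved. *)

(** * Divisibility in the local ring of rationals integral at p *)

(* q lies in p ^ n Z_(p). *)
Definition pdvd (p n : nat) (q : rat) : Prop :=
  exists a b : int, ~~ (p %| b)%Z /\ q * b%:~R = (p ^ n)%:R * a%:~R.

Section PDivisibility.
Variable p : nat.
Hypothesis p_prime : prime p.
Implicit Types (n m k : nat) (q r : rat).

Lemma prime_ndvdzM (a b : int) :
  ~~ (p %| a)%Z -> ~~ (p %| b)%Z -> ~~ (p %| a * b)%Z.
Proof. by rewrite !dvdzE abszM /= Euclid_dvdM // negb_or => -> ->. Qed.

Lemma ndvdz_neq0 (b : int) : ~~ (p %| b)%Z -> b%:~R != 0 :> rat.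
Proof. by apply: contraNneq => /eqP; rewrite intr_eq0 => /eqP ->; exact: dvdz0. Qed.

Lemma pdvd_int n (a : int) : ((p ^ n)%N%:Z %| a)%Z -> pdvd p n a%:~R.
Proof.
move=> /dvdzP[c ->]; exists c, 1; split; last by rewrite mulr1 rmorphM mulrC.
by rewrite dvdzE /= dvdn1; apply: contraTneq p_prime => ->.
Qed.

Lemma pdvd_nat n (a : nat) : (p ^ n %| a)%N -> pdvd p n a%:R.
Proof. by move=> h; rewrite pmulrn; apply: pdvd_int. Qed.

Lemma pdvd0 n : pdvd p n 0.
Proof. by apply: (@pdvd_int n 0); exact: dvdz0. Qed.

Lemma pint_int (a : int) : pdvd p 0 a%:~R.
Proof. by apply: pdvd_int; rewrite expn0 dvd1z. Qed.

Lemma pint_nat (a : nat) : pdvd p 0 a%:R.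
Proof. by apply: pdvd_nat; rewrite expn0 dvd1n. Qed.

Lemma pint_sign k : pdvd p 0 ((-1) ^+ k).
Proof. by rewrite -[_ ^+ k](rmorph_sign intr); exact: pint_int. Qed.

Lemma pdvdD n q r : pdvd p n q -> pdvd p n r -> pdvd p n (q + r).
Proof.
move=> [a [b [pb qb]]] [c [d [pd rd]]].
exists (a * d + c * b), (b * d); split; first exact: prime_ndvdzM.
rewrite !rmorphD !rmorphM /= mulrDl mulrA qb [_%:~R * d%:~R]mulrC mulrA rd.
by ring.
Qed.

Lemma pdvdM n m q r : pdvd p n q -> pdvd p m r -> pdvd p (n + m) (q * r).
Proof.
move=> [a [b [pb qb]]] [c [d [pd rd]]].
exists (a * c), (b * d); split; first exact: prime_ndvdzM.
by rewrite !rmorphM /= mulrACA qb rd expnD natrM; ring.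
Qed.

Lemma pdvdMl n q r : pdvd p 0 q -> pdvd p n r -> pdvd p n (q * r).
Proof. exact: pdvdM. Qed.

Lemma pdvdMr n q r : pdvd p n q -> pdvd p 0 r -> pdvd p n (q * r).
Proof. by rewrite mulrC => ? ?; exact: pdvdMl. Qed.

Lemma pdvdN n q : pdvd p n q -> pdvd p n (- q).
Proof. by rewrite -mulN1r; apply: pdvdMl; apply: (pint_sign 1). Qed.

Lemma pdvdB n q r : pdvd p n q -> pdvd p n r -> pdvd p n (q - r).
Proof. by move=> ? ?; apply: pdvdD => //; exact: pdvdN. Qed.

Lemma pdvd_sum n (I : Type) (s : seq I) (P : pred I) (F : I -> rat) :
  (forall i, P i -> pdvd p n (F i)) -> pdvd p n (\sum_(i <- s | P i) F i).
Proof. by move=> FP; apply: big_ind FP; [exact: pdvd0 | exact: pdvdD]. Qed.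

Lemma pdvd_exp n : pdvd p n (p%:R ^+ n).
Proof. by rewrite -natrX; apply: pdvd_nat. Qed.

Lemma pdvd_le n m q : (m <= n)%N -> pdvd p n q -> pdvd p m q.
Proof.
move=> mn [a [b [pb qb]]]; exists ((p ^ (n - m))%N%:Z * a), b; split => //.
by rewrite qb -{1}(subnKC mn) expnD natrM rmorphM /= mulrA.
Qed.

Lemma pint n q : pdvd p n q -> pdvd p 0 q.
Proof. exact: pdvd_le. Qed.

Lemma pint_natV j : (0 < j < p)%N -> pdvd p 0 (j%:R^-1).
Proof.
move=> /andP[j0 jp]; exists 1, j%:Z; split.
  by rewrite dvdzE /= gtnNdvd.
by rewrite expn0 mulVf ?pnatr_eq0 -?lt0n.
Qed.

(** Passage from [pdvd] to the numerator in lowest terms, the form in which both the conjecture and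
    [ratmod] see divisibility. *)
Lemma pdvd_coprime_num n q : pdvd p n q -> ((p ^ n)%N%:Z %| numq q)%Z.
Proof.
move=> [a [b [pb qb]]].
have pb' : coprimez (p ^ n)%N%:Z b.
  rewrite /coprimez /gcdz /= -[_ == _]/(coprime _ _); apply: coprimeXl.
  by rewrite prime_coprime // -[(_ %| _)%N]/(p %| b)%Z.
rewrite -(Gauss_dvdzl _ pb').
have : (numq q * b)%:~R = ((p ^ n)%N%:Z * (a * denq q))%:~R :> rat.
  rewrite !rmorphM /= -[X in X * _](divfK (_ : (denq q)%:~R != 0 :> rat)).
    by rewrite divq_num_den mulrAC qb; ring.
  by rewrite intr_eq0 denq_neq0.
by move/eqP; rewrite eqr_int => /eqP ->; rewrite dvdz_mulr.
Qed.

Lemma pint_denq q : pdvd p 0 q -> ~~ (p %| denq q)%Z.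
Proof.
move=> [a [b [pb qb]]].
have : (numq q * b)%:~R = (a * denq q)%:~R :> rat.
  rewrite !rmorphM /= -[X in X * _](divfK (_ : (denq q)%:~R != 0 :> rat)).
    by rewrite divq_num_den mulrAC qb expn0; ring.
  by rewrite intr_eq0 denq_neq0.
move=> /eqP; rewrite eqr_int => /eqP E; apply: contra pb => pd.
have cp : coprimez p%:Z (numq q).
  rewrite /coprimez /gcdz /= -[_ == _]/(coprime _ _) prime_coprime //.
  apply/negP => pn; have := coprime_num_den q; rewrite /coprime.
  have : (p %| gcdn `|numq q| `|denq q|)%N by rewrite dvdn_gcd pn.
  move=> + /eqP pg; rewrite pg dvdn1 => /eqP p1.
  by move: p_prime; rewrite p1.
by rewrite -(Gauss_dvdzr _ cp) E dvdz_mull.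
Qed.

Lemma pdvd_numq n q : pdvd p 0 q -> ((p ^ n)%N%:Z %| numq q)%Z -> pdvd p n q.
Proof.
move=> /pint_denq pd /dvdzP[c cE]; exists c, (denq q); split => //.
by rewrite -{1}(divq_num_den q) divfK ?intr_eq0 ?denq_neq0 // cE rmorphM mulrC.
Qed.

Lemma pdvd_cancel n q r : pdvd p n (q * r) -> pdvd p 0 q^-1 -> q != 0 -> pdvd p n r.
Proof. by move=> h qi q0; rewrite -[r](mulKf q0); exact: pdvdMl. Qed.

Lemma pint_inv1 q : pdvd p 1 (q + 1) -> pdvd p 0 (q^-1) /\ q != 0.
Proof.
move=> [a [b [pb qb]]]; rewrite expn1 in qb.
have {}qb : q * b%:~R = (p%:Z * a - b)%:~R.
  by rewrite rmorphB rmorphM /= -qb; ring.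
have nd : ~~ (p %| p%:Z * a - b)%Z.
  by rewrite rpredBl ?dvdz_mulr.
have q0 : q != 0.
  by apply: contraTneq (ndvdz_neq0 nd) => q0; rewrite -qb q0 mul0r eqxx.
split => //; exists b, (p%:Z * a - b); split => //.
by rewrite -qb mulKf // expn0 mul1r.
Qed.

End PDivisibility.

(** * The polynomial (X + 1) ... (X + p - 1) *)

Lemma coef_X1Xn (R : nzRingType) i j : (('X + 1 : {poly R}) ^+ i)`_j = 'C(i, j)%:R.
Proof.
rewrite addrC exprDn_comm; last exact: commr_sym (commr1 _).
under eq_bigr => k _ do rewrite expr1n mul1r.
rewrite coef_sum; under eq_bigr => k _ do rewrite coefMn coefXn.
have [ji|ij] := ltnP j i.+1; last first.
  rewrite bin_small // big1 // => k _; rewrite gtn_eqF ?mul0rn //.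
  exact: leq_trans (ltn_ord k) ij.
rewrite (bigD1 (Ordinal ji)) //= eqxx big1 ?addr0 // => k /negP kj.
case: eqP => [jk|]; last by rewrite mul0rn.
by case: kj; apply/eqP/val_inj.
Qed.

Lemma coef_comp_X1 (q : {poly rat}) n j : (size q <= n)%N ->
  (q \Po ('X + 1))`_j = \sum_(i < n) q`_i * 'C(i, j)%:R.
Proof.
move=> qn; rewrite comp_polyE coef_sum (big_ord_widen _ (fun i => (q`_i *: ('X + 1) ^+ i)`_j) qn).
rewrite big_mkcond; apply: eq_bigr => i _.
by case: ltnP => [_|/leq_sizeP/(_ i)->//]; rewrite ?mul0r // coefZ coef_X1Xn.
Qed.

(** Its coefficients are unsigned Stirling numbers of the first kind: that of X^j is c(p, j + 1), in
    particular (p - 1)! for j = 0. *)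
Definition rising (p : nat) : {poly rat} := \prod_(1 <= i < p) ('X + i%:R%:P).

Lemma rising_XsubC p : rising p = \prod_(1 <= i < p) ('X - (- i%:R)%:P).
Proof. by apply: eq_bigr => i _; rewrite polyCN opprK. Qed.

Lemma size_rising p : (0 < p)%N -> size (rising p) = p.
Proof. by move=> p0; rewrite rising_XsubC size_prod_XsubC size_iota subn1 prednK. Qed.

Lemma rising_lead p : (0 < p)%N -> (rising p)`_p.-1 = 1.
Proof.
move=> p0; rewrite -{2}(size_rising p0) -[_`_ _]/(lead_coef _); apply/eqP.
by rewrite rising_XsubC -monicE; exact: monic_prod_XsubC.
Qed.

Lemma rising_coef0 p : (rising p)`_0 = \prod_(1 <= i < p) i%:R.
Proof.
by rewrite -horner_coef0 horner_prod; apply: eq_bigr => i _; rewrite !hornerE.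
Qed.

(** Shifting X (X + 1) ... (X + p - 1) by one gives (X + 1) ... (X + p), which is (X + p) times
    [rising p]. *)
Lemma rising_shift p : (0 < p)%N ->
  ('X * rising p) \Po ('X + 1) - 'X * rising p = p%:R *: rising p.
Proof.
move=> p0; apply/eqP; rewrite subr_eq; apply/eqP.
rewrite -mul_polyC -mulrDl rmorphM /= comp_polyX.
elim: p p0 => // -[_|p IH] _.
  by rewrite /rising big_nil rmorph1 !mulr1 addrC.
have := IH isT; rewrite /rising !(@big_nat_recr _ _ _ p.+1) //= => E.
rewrite rmorphM mulrA E rmorphD /= comp_polyX comp_polyC.
by rewrite -[in RHS]addn1 natrD polyCD -addn1 natrD polyCD; ring.
Qed.

(** Coefficient of X^j in [rising_shift]; the term i = j - 1 has binomial coefficient 1 and cancels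
    against the unshifted polynomial. The first remaining term is j + 1 times the coefficient of
    index j, so the relation is solved downwards, from high to low index. *)
Lemma rising_rec p j : (j < p)%N ->
  \sum_(j <= i < p) (rising p)`_i * 'C(i.+1, j)%:R = p%:R * (rising p)`_j.
Proof.
move=> jp; have p0 : (0 < p)%N by exact: leq_trans jp.
have := congr1 (fun q : {poly rat} => q`_j) (rising_shift p0).
rewrite coefB coefZ => <-.
rewrite (@coef_comp_X1 _ p.+1); last first.
  by rewrite (leq_trans (size_polyMleq _ _)) // size_polyX size_rising.
rewrite big_ord_recl. rewrite coefXM eqxx mul0r add0r.
under [X in _ = X - _]eq_bigr => i _ do rewrite coefXM /=.
rewrite -(big_mkord xpredT (fun i => (rising p)`_i * 'C(i.+1, j)%:R)).
rewrite [X in _ = X - _](@big_cat_nat _ _ _ j) //=; last exact: ltnW.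
rewrite addrC coefXM; apply/esym/eqP; rewrite subr_eq addrC eq_sym; apply/eqP.
rewrite addrC; congr (_ + _); case: j jp => [|j] jp; first by rewrite big_nil.
rewrite big_nat_recr //= binn mulr1 big_nat_cond big1 ?add0r // => i /andP[/andP[_ ij] _].
by rewrite bin_small // mulr0.
Qed.

Lemma down_ind (P : nat -> Prop) m :
  (forall j, (j < m)%N -> (forall i, (j < i < m)%N -> P i) -> P j) ->
  forall j, (j < m)%N -> P j.
Proof.
move=> IH; suff H r : forall j, (j < m)%N -> (m <= j + r)%N -> P j.
  by move=> j jm; apply: (H m) => //; exact: leq_addl.
elim: r => [|r IHr] j jm; first by rewrite addn0 leqNgt jm.
move=> mjr; apply: IH => // i /andP[ji im]; apply: IHr => //.
by rewrite (leq_trans mjr) // addnS -addSn leq_add2r.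
Qed.

Lemma odd_gt2_prime p : prime p -> (2 < p)%N -> odd p.
Proof. by move=> /even_prime[->|]. Qed.

(** * Coefficients of [rising p] modulo p and p^2, and Bernoulli numbers *)

Section LocalCoefficients.
Variable p : nat.
Hypothesis p_prime : prime p.
Let p_gt0 : (0 < p)%N := prime_gt0 p_prime.

Lemma pint_rising j : pdvd p 0 (rising p)`_j.
Proof.
move: j; rewrite /rising;
apply: (big_ind (fun f : {poly rat} => forall j, pdvd p 0 f`_j)) => [j|f g fP gP j|i _ j].
- by rewrite coef1; exact: pint_nat.
- rewrite coefM; apply: (pdvd_sum p_prime) => i _.
  by apply: (pdvdMl p_prime); [exact: fP | exact: gP].
- rewrite coefD coefX coefC; apply: pdvdD => //; first exact: pint_nat.
  by case: ifP => _; [exact: pint_nat | exact: pdvd0].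
Qed.

Lemma rising_rec_mid j : (0 < j < p.-1)%N ->
  \sum_(j <= i < p.-1) (rising p)`_i * 'C(i.+1, j)%:R =
    p%:R * (rising p)`_j - 'C(p, j)%:R.
Proof.
move=> /andP[j0 jp]; rewrite -rising_rec; last by rewrite (leq_trans jp) ?leq_pred.
rewrite -[in RHS](prednK p_gt0) big_nat_recr /=; last by rewrite ltnW.
by rewrite prednK // rising_lead // mul1r addrK.
Qed.

(** In [rising_rec_mid] everything but the term i = j is divisible by p, by downward induction and
    because p divides C(p, j); the factor j + 1 < p of that term is invertible. *)
Lemma pdvd_rising j : (0 < j < p.-1)%N -> pdvd p 1 (rising p)`_j.
Proof.
move=> /andP[+ jp]; move: j jp; apply: down_ind => j jp IH j0.
have j1p : (0 < j.+1 < p)%N by rewrite /= -ltn_predRL.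
apply: (@pdvd_cancel p p_prime _ j.+1%:R); last 2 first.
- exact: pint_natV.
- by rewrite pnatr_eq0.
have := rising_rec_mid (introT andP (conj j0 jp)).
rewrite big_ltn // binSn mulrC => /eqP.
rewrite eq_sym -subr_eq => /eqP <-.
apply: (pdvdB p_prime).
  apply: (pdvdB p_prime); last first.
    apply: pdvd_nat => //; rewrite expn1 prime_dvd_bin // j0 /=.
    by rewrite (leq_trans jp) ?leq_pred.
  by apply: pdvdMr => //; [exact: (pdvd_exp p_prime 1) | exact: pint_rising].
rewrite big_nat; apply: (pdvd_sum p_prime) => i /andP[ji ip].
apply: pdvdMr => //; last exact: pint_nat.
by apply: IH; rewrite ?ji // (leq_trans _ ji).
Qed.

(** Wilson's theorem, from [rising_rec] at j = 0: the middle coefficients are divisible by p and the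
    leading one is 1. *)
Lemma rising0_mod : (2 < p)%N -> pdvd p 1 ((rising p)`_0 + 1).
Proof.
move=> p2; have := rising_rec p_gt0.
rewrite -{1}(prednK p_gt0) big_nat_recr //= rising_lead // bin0 mul1r.
rewrite big_ltn ?ltn_predRL ?(ltnW p2) // bin0 mulr1 => /eqP.
rewrite addrAC eq_sym -subr_eq => /eqP <-.
apply: (pdvdB p_prime).
  by apply: pdvdMr => //; [exact: (pdvd_exp p_prime 1) | exact: pint_rising].
rewrite big_nat; apply: (pdvd_sum p_prime) => i /andP[ji ip].
apply: pdvdMr => //; last exact: pint_nat.
by apply: pdvd_rising; rewrite ji.
Qed.

Lemma pint_rising0V : (2 < p)%N -> pdvd p 0 ((rising p)`_0)^-1 /\ (rising p)`_0 != 0.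
Proof. by move=> p2; apply: pint_inv1 => //; exact: rising0_mod. Qed.

Lemma bernoulli0 : bernoulli 0 = 1.
Proof. by have := bernoulli_rec 0; rewrite big_ord1 mul1r. Qed.

(** The recursion up to B_r divides only by integers at most r + 1 < p. *)
Lemma pint_bernoulli r : (r < p.-1)%N -> pdvd p 0 (bernoulli r).
Proof.
elim/ltn_ind: r => r IH rp.
apply: (@pdvd_cancel p p_prime _ r.+1%:R); last 2 first.
- by apply: pint_natV; rewrite //= -ltn_predRL.
- by rewrite pnatr_eq0.
have := bernoulli_rec r; rewrite big_ord_recr /= binSn => /eqP.
rewrite addrC eq_sym -subr_eq => /eqP <-; apply: (pdvdB p_prime).
  exact: pint_nat.
apply: (pdvd_sum p_prime) => i _; apply: pdvdMl => //; first exact: pint_nat.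
by apply: IH => //; exact: ltn_trans rp.
Qed.

(* The right-hand term is the binomial coefficient of - r and t. *)
Lemma bin_prime_sub r t : (0 < r)%N -> (r + t <= p)%N ->
  pdvd p 1 ('C(p - r, t)%:R - (-1) ^+ t * 'C((r + t).-1, t)%:R).
Proof.
move=> r0; elim: t => [_|t IH rtp].
  by rewrite !bin0 expr0 mul1r subrr; exact: pdvd0.
apply: (@pdvd_cancel p p_prime _ t.+1%:R); last 2 first.
- by apply: pint_natV; lia.
- by rewrite pnatr_eq0.
have e1 : t.+1%:R * 'C(p - r, t.+1)%:R = (p - r - t)%:R * 'C(p - r, t)%:R :> rat.
  by rewrite -!natrM mul_bin_left.
have e2 : t.+1%:R * 'C((r + t.+1).-1, t.+1)%:R = (r + t)%:R * 'C((r + t).-1, t)%:R :> rat.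
  by rewrite -!natrM addnS /= -mul_bin_diag.
have -> : t.+1%:R * ('C(p - r, t.+1)%:R - (-1) ^+ t.+1 * 'C((r + t.+1).-1, t.+1)%:R)
  = (p - r - t)%:R * ('C(p - r, t)%:R - (-1) ^+ t * 'C((r + t).-1, t)%:R)
    + p%:R * ((-1) ^+ t * 'C((r + t).-1, t)%:R) :> rat.
  rewrite mulrBr e1 mulrCA e2 !natrB; [|lia..].
  by rewrite exprS natrD; ring.
apply: (pdvdD p_prime).
  by apply: pdvdMl => //; [exact: pint_nat | apply: IH; lia].
apply: pdvdMr => //; first exact: (pdvd_exp p_prime 1).
by apply: pdvdMl => //; [exact: pint_sign | exact: pint_nat].
Qed.

(** Put i = p - 1 - r and s = p - 1 - j. The binomial coefficient becomes C(p - 1 - r, s + 1 - r),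
    which modulo p is C(s + 1, r) up to sign since p - 1 - r is -(r + 1). What is left is the
    Bernoulli recursion at s > 0, whose value is 0. *)
Lemma bernoulli_bin_sum j : odd p -> (0 < j < p.-1)%N ->
  pdvd p 1 (\sum_(j <= i < p) (-1) ^+ i * bernoulli (p.-1 - i) * 'C(i, j.-1)%:R).
Proof.
move=> p_odd /andP[j0 jp].
pose s := (p.-1 - j)%N.
have sE : (p - j = s.+1)%N by rewrite /s; lia.
rewrite -{1}[j]add0n big_addn sE big_mkord.
(* The subtracted terms add up to zero: up to a common sign they form [bernoulli_rec s]. *)
have <- : \sum_(r < s.+1) ((-1) ^+ r * bernoulli r *
    ('C(p - r.+1, s.+1 - r)%:R - (-1) ^+ (s.+1 - r) * 'C(s.+1, r)%:R)) =
   \sum_(i < s.+1) (-1) ^+ (i + j) * bernoulli (p.-1 - (i + j)) * 'C(i + j, j.-1)%:R.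
  rewrite [RHS](reindex_inj rev_ord_inj) /=.
  under eq_bigr => r _ do rewrite mulrBr.
  rewrite sumrB [X in _ - X](_ : _ = 0) ?subr0; last first.
    have s0 : s != 0%N by rewrite /s; lia.
    have := bernoulli_rec s; rewrite (negPf s0) => /(congr1 ( *%R ((-1) ^+ s.+1))).
    rewrite mulr0 big_distrr /= => E; rewrite -[RHS]E; apply: eq_bigr => r _.
    have rs : (r <= s.+1)%N by apply/ltnW/ltn_ord.
    have -> : (-1) ^+ s.+1 = (-1) ^+ (s.+1 - r) * (-1) ^+ r :> rat by rewrite -exprD subnK.
    by ring.
  apply: eq_bigr => r _; have rs : (r <= s)%N by exact: ltn_ord r.
  have -> : (s.+1 - r.+1 + j = p.-1 - r)%N by lia.
  have -> : (p.-1 - (p.-1 - r) = r)%N by lia.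
  have -> : (p - r.+1 = p.-1 - r)%N by lia.
  congr (_ * _ * _).
    rewrite -signr_odd -[in RHS]signr_odd oddB; last by lia.
    by rewrite -subn1 oddB // p_odd.
  by rewrite -[in RHS]bin_sub; [congr ('C(_, _)%:R); lia | lia].
apply: (pdvd_sum p_prime) => r _; have rs : (r <= s)%N by exact: ltn_ord r.
apply: pdvdMl => //.
  by apply: pdvdMl => //; [exact: pint_sign | apply: pint_bernoulli; lia].
have := @bin_prime_sub r.+1 (s.+1 - r)%N isT _.
have -> : ((r.+1 + (s.+1 - r)).-1 = s.+1)%N by lia.
rewrite bin_sub; last by lia.
by apply; lia.
Qed.

(* Modulo p, the recursion for the digits (rising p)`_j / p is the one defining
   the Bernoulli numbers. *)
Lemma rising_bernoulli j : (2 < p)%N -> (0 < j < p.-1)%N ->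
  pdvd p 2 ((rising p)`_j - p%:R * ((-1) ^+ j * bernoulli (p.-1 - j) / j.+1%:R)).
Proof.
move=> p2 /andP[+ jp]; move: j jp; apply: down_ind => j jp IH j0.
have p_odd := odd_gt2_prime p_prime p2.
pose psi i : rat := (-1) ^+ i * bernoulli (p.-1 - i) / i.+1%:R.
have j1p : (0 < j.+1 < p)%N by rewrite /= -ltn_predRL.
apply: (@pdvd_cancel p p_prime _ j.+1%:R); last 2 first.
- exact: pint_natV.
- by rewrite pnatr_eq0.
(* Trades the denominator i + 1, which varies with the term, for the fixed denominator j. *)
have psiE i : (0 < i)%N -> psi i * 'C(i.+1, j)%:R =
    (-1) ^+ i * bernoulli (p.-1 - i) * 'C(i, j.-1)%:R / j%:R.
  move=> i0; rewrite /psi.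
  have : j%:R * 'C(i.+1, j)%:R = i.+1%:R * 'C(i, j.-1)%:R :> rat.
    by rewrite -!natrM -{2}(prednK j0) mul_bin_diag prednK.
  move=> E; have jn0 : j%:R != 0 :> rat by rewrite pnatr_eq0 -lt0n.
  have -> : 'C(i.+1, j)%:R = i.+1%:R * 'C(i, j.-1)%:R / j%:R :> rat.
    by rewrite -E mulrAC divff // mul1r.
  by field; rewrite jn0 nat1r pnatr_eq0.
have j0' : j%:R != 0 :> rat by rewrite pnatr_eq0 -lt0n.
have jV : pdvd p 0 j%:R^-1 by apply: pint_natV; rewrite // j0 (leq_trans jp) ?leq_pred.
have p0' : p%:R != 0 :> rat by rewrite pnatr_eq0 -lt0n.
have binp : 'C(p, j)%:R = p%:R * ('C(p.-1, j.-1)%:R / j%:R) :> rat.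
  have E : (j * 'C(p, j) = p * 'C(p.-1, j.-1))%N by rewrite mul_bin_diag prednK.
  apply: (mulfI j0'); rewrite -natrM E natrM.
  by field.
(* The isolated term is the one of index i = p - 1, where B_0 = 1 and the sign is + as p is odd. It
   is C(p, j) / p, the contribution of the leading coefficient. *)
have main : pdvd p 1 (\sum_(j <= i < p.-1) psi i * 'C(i.+1, j)%:R +
    'C(p.-1, j.-1)%:R / j%:R).
  have -> : \sum_(j <= i < p.-1) psi i * 'C(i.+1, j)%:R + 'C(p.-1, j.-1)%:R / j%:R =
      (\sum_(j <= i < p) (-1) ^+ i * bernoulli (p.-1 - i) * 'C(i, j.-1)%:R) / j%:R.
    have recr (F : nat -> rat) : \sum_(j <= i < p) F i = \sum_(j <= i < p.-1) F i + F p.-1.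
      by rewrite -[in LHS](prednK p_gt0) big_nat_recr //= ltnW.
    rewrite [in RHS]recr.
    rewrite mulrDl subnn bernoulli0 mulr1 big_distrl /=; congr (_ + _).
      rewrite [LHS]big_nat [RHS]big_nat; apply: eq_bigr => i /andP[ji _].
      by rewrite psiE ?(leq_trans j0).
    by rewrite -signr_odd -subn1 oddB // p_odd mul1r.
  by apply: pdvdMr => //; apply: bernoulli_bin_sum; rewrite // j0.
have rec := rising_rec_mid (introT andP (conj j0 jp)).
(* Difference of the two recursions. Each summand is divisible by p^2: the first by [pdvd_rising],
   the second by [main], the third by induction. *)
have -> : j.+1%:R * ((rising p)`_j - p%:R * psi j) =
    p%:R * (rising p)`_j
    - p%:R * (\sum_(j <= i < p.-1) psi i * 'C(i.+1, j)%:R + 'C(p.-1, j.-1)%:R / j%:R)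
    - \sum_(j.+1 <= i < p.-1) ((rising p)`_i - p%:R * psi i) * 'C(i.+1, j)%:R.
  have -> : \sum_(j.+1 <= i < p.-1) ((rising p)`_i - p%:R * psi i) * 'C(i.+1, j)%:R =
     \sum_(j.+1 <= i < p.-1) (rising p)`_i * 'C(i.+1, j)%:R -
     p%:R * \sum_(j.+1 <= i < p.-1) psi i * 'C(i.+1, j)%:R.
    rewrite big_distrr /= -sumrB; apply: eq_bigr => i _.
    by rewrite mulrBl mulrA.
  move: rec; rewrite binp !(big_ltn jp) !binSn => /eqP.
  rewrite -subr_eq0 => /eqP rec; apply/eqP; rewrite -subr_eq0; apply/eqP.
  by rewrite -[RHS]rec; ring.
apply: (pdvdB p_prime); first apply: (pdvdB p_prime).
- by apply: (@pdvdM p p_prime 1 1); [exact: (pdvd_exp p_prime 1) | apply: pdvd_rising; rewrite j0].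
- by apply: (@pdvdM p p_prime 1 1) => //; exact: (pdvd_exp p_prime 1).
rewrite big_nat; apply: (pdvd_sum p_prime) => i /andP[ji ip].
apply: pdvdMr => //; last exact: pint_nat.
by apply: IH; rewrite ?ji // (leq_trans _ ji).
Qed.

End LocalCoefficients.

(** * Elementary symmetric polynomials of p/1, ..., p/(p-1) *)

Definition elem_val (s : seq rat) (k : nat) : rat := (\prod_(a <- s) (1 + a *: 'X))`_k.

Section ElemPlist.
Variable p : nat.
Hypothesis p_prime : prime p.
Hypothesis p_gt2 : (2 < p)%N.
Let p_gt0 : (0 < p)%N := prime_gt0 p_prime.
Let E k := elem_val (plist p) k.

Lemma prod_plist (A : comNzRingType) (f : rat -> A) :
  \prod_(a <- plist p) f a = \prod_(1 <= i < p) f (p%:R / i%:R).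
Proof. by rewrite /plist big_map /index_iota subn1. Qed.

(** From 1 + p X / i = (p X + i) / i, the generating polynomial is [rising p] at p X, divided by (p
    - 1)!. *)
Lemma elem_val_rising k : E k = p%:R ^+ k * (rising p)`_k / (rising p)`_0.
Proof.
rewrite /E /elem_val prod_plist rising_coef0.
have -> : \prod_(1 <= i < p) (1 + p%:R / i%:R *: 'X) =
    (\prod_(1 <= i < p) i%:R)^-1 *: (rising p \Po (p%:R *: 'X)) :> {poly rat}.
  rewrite /rising rmorph_prod /= -prodfV -scaler_prod.
  rewrite [LHS]big_nat [RHS]big_nat; apply: eq_bigr => i /andP[i0 _].
  have cd : (i%:R^-1)%:P * i%:R%:P = 1 :> {poly rat}.
    by rewrite -polyCM mulVf ?pnatr_eq0 -?lt0n.
  by rewrite comp_polyD comp_polyX comp_polyC -!mul_polyC polyCM -cd; ring.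
rewrite coefZ mulrC; congr (_ / _).
rewrite comp_polyE coef_sum.
under eq_bigr => i _ do rewrite exprZn !coefZ coefXn.
have [kp|pk] := ltnP k (size (rising p)).
  rewrite (bigD1 (Ordinal kp)) //= eqxx mulr1 mulrC big1 ?addr0 // => i ik.
  rewrite [k == i]eq_sym (_ : (i == k :> nat) = false) ?mulr0 //.
  by apply/negP => /eqP e; case/eqP: ik; apply: val_inj.
rewrite [in RHS]nth_default // mulr0 big1 // => i _.
by rewrite gtn_eqF ?mulr0 // (leq_trans (ltn_ord i)).
Qed.

Lemma elem_val_eq0 k : (p <= k)%N -> E k = 0.
Proof. by move=> pk; rewrite elem_val_rising nth_default ?size_rising // mulr0 mul0r. Qed.

Lemma pdvd_elem_val k : pdvd p k (E k).
Proof.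
have [r0 _] := pint_rising0V p_prime p_gt2.
rewrite elem_val_rising -mulrA; apply: pdvdMr => //; first exact: pdvd_exp.
by apply: pdvdMl => //; exact: pint_rising.
Qed.

(** The source of the H-degree k + 1: one factor p beyond p^k comes from [pdvd_rising]. At k = p - 1
    the coefficient is 1 and gives no such factor. *)
Lemma pdvd_elem_valS k : (0 < k < p.-1)%N -> pdvd p k.+1 (E k).
Proof.
move=> kp; have [r0 _] := pint_rising0V p_prime p_gt2.
rewrite elem_val_rising; apply: pdvdMr => //; rewrite -addn1.
by apply: pdvdM => //; [exact: pdvd_exp | exact: pdvd_rising].
Qed.

(** Two errors add up: that of [rising_bernoulli], with sign + for even k, and that of replacing 1 /
    (p - 1)! by -1, which produces the minus sign. *)
Lemma elem_val_bernoulli k : ~~ odd k -> (0 < k < p.-1)%N ->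
  pdvd p k.+2 (E k - p%:R ^+ k.+1 * - (bernoulli (p - k.+1) / k.+1%:R)).
Proof.
move=> k_even kp; have [r0 rn0] := pint_rising0V p_prime p_gt2.
have kB : pdvd p 0 (bernoulli (p - k.+1) / k.+1%:R).
  by apply: pdvdMl => //; [apply: pint_bernoulli => //; lia | apply: pint_natV => //; lia].
rewrite elem_val_rising.
have -> : p%:R ^+ k * (rising p)`_k / (rising p)`_0 -
    p%:R ^+ k.+1 * - (bernoulli (p - k.+1) / k.+1%:R) =
  (p%:R ^+ k * ((rising p)`_k - p%:R * (bernoulli (p - k.+1) / k.+1%:R)) +
   p%:R ^+ k.+1 * ((bernoulli (p - k.+1) / k.+1%:R) * ((rising p)`_0 + 1))) / (rising p)`_0.
  by rewrite exprS; field; rewrite rn0 nat1r pnatr_eq0.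
apply: pdvdMr => //; apply: (pdvdD p_prime).
  rewrite -addn2; apply: pdvdM => //; first exact: pdvd_exp.
  have := rising_bernoulli p_prime p_gt2 kp.
  rewrite -signr_odd (negPf k_even) expr0 mul1r.
  by have -> : (p.-1 - k = p - k.+1)%N by lia.
rewrite -[k.+2]addn1; apply: pdvdM => //; first exact: pdvd_exp.
by apply: pdvdMl => //; exact: rising0_mod.
Qed.

(* The roots - i/p of X |-> prod_i (1 + p X / i) are permuted by X |-> -1 - X. *)
Lemma elem_val_reflection k :
  E k = \sum_(j < p) (-1) ^+ j * 'C(j, k)%:R * E j.
Proof.
have p1_even : odd p.-1 = false.
  by rewrite -subn1 oddB // (odd_gt2_prime p_prime p_gt2).
pose P : {poly rat} := \prod_(1 <= i < p) (1 + p%:R / i%:R *: 'X).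
have EP j : E j = P`_j by rewrite /E /elem_val prod_plist.
have PE : P \Po (- ('X + 1)) = P.
  (* The reflection takes 1 + p X / i to (i - p) / i times 1 + p X / (p - i). It thus exchanges i
     and p - i up to constants, whose product is (-1)^(p-1) = 1. *)
  have c1 : \prod_(1 <= i < p) ((i%:R - p%:R) / i%:R)%:P = 1 :> {poly rat}.
    rewrite -rmorph_prod /= big_split /= prodfV.
    have -> : \prod_(1 <= i < p) (i%:R - p%:R) = \prod_(1 <= i < p) i%:R :> rat.
      transitivity (\prod_(1 <= i < p) (-1 * (p - i)%:R) : rat).
        by apply: eq_big_nat => i /andP[_ ip]; rewrite natrB ?mulN1r ?opprB // ltnW.
      rewrite big_split /= prodr_const_nat -signr_odd subn1 p1_even mul1r.
      rewrite big_nat_rev /=; apply: eq_big_nat => i /andP[_ ip].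
      by congr (_%:R); lia.
    by rewrite -rising_coef0 divff // (pint_rising0V p_prime p_gt2).2.
  rewrite /P rmorph_prod /= [RHS]big_nat_rev /= -[RHS]mul1r -[X in _ = X * _]c1 -big_split /=.
  apply: eq_big_nat => i /andP[i0 ip].
  rewrite rmorphD rmorph1 /= comp_polyZ comp_polyX.
  have -> : (1 + p - i.+1 = p - i)%N by lia.
  have cd : (i%:R^-1)%:P * i%:R%:P = 1 :> {poly rat}.
    by rewrite -polyCM mulVf ?pnatr_eq0 -?lt0n.
  have cd' : ((p - i)%:R^-1)%:P * (p%:R%:P - i%:R%:P) = 1 :> {poly rat}.
    by rewrite -polyCB -natrB 1?ltnW // -polyCM mulVf // pnatr_eq0; lia.
  rewrite -!mul_polyC !polyCM polyCB; set c' := ((p - i)%:R^-1)%:P in cd' *.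
  set c := (i%:R^-1)%:P in cd *; set d := i%:R%:P in cd cd' *; set q := p%:R%:P in cd' *.
  transitivity (c * d - q * c - q * c * 'X * (c' * (q - d))).
    by rewrite cd cd'; ring.
  by ring.
rewrite !EP -{1}PE comp_polyE coef_sum.
transitivity (\sum_(j < size P) (-1) ^+ j * 'C(j, k)%:R * P`_j).
  apply: eq_bigr => j _.
  have -> : (- ('X + 1)) ^+ j = ((-1) ^+ j)%:P * ('X + 1) ^+ j :> {poly rat}.
    by rewrite [LHS]exprNn polyC_exp polyCN.
  by rewrite mul_polyC !coefZ coef_X1Xn mulrC.
have sP : (size P <= p)%N.
  by apply/leq_sizeP => j pj; rewrite -EP elem_val_eq0.
rewrite (big_ord_widen _ (fun j => (-1) ^+ j * 'C(j, k)%:R * P`_j) sP) big_mkcond.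
apply: eq_bigr => j _; rewrite EP; case: ltnP => // /leq_sizeP/(_ j)-> //.
by rewrite mulr0.
Qed.

End ElemPlist.

(** * The Bernoulli conjecture for explicit sums of monomials *)

(* In a module, because the notations of mpoly clash with those of monalg. *)
Module Export MonomialSums.
Import mpoly.

Section WeightedHomogeneous.
Variable m : nat.
Implicit Types (q r : {mpoly rat[m]}) (d e : nat).

Lemma whomogD d q r : odd_whomog d q -> odd_whomog d r -> odd_whomog d (q + r).
Proof. by move=> qd rd a /msuppD_le; rewrite mem_cat => /orP[/qd|/rd]. Qed.

Lemma whomogZ d c q : odd_whomog d q -> odd_whomog d (c *: q).
Proof. by move=> qd a /msuppZ_le/qd. Qed.

Lemma whomogM d e q r :
  odd_whomog d q -> odd_whomog e r -> odd_whomog (d + e) (q * r).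
Proof.
move=> qd re a /msuppM_le/allpairsP[[b c] /= [/qd <- /re <- ->]].
by rewrite -big_split /=; apply: eq_bigr => i _; rewrite mnmDE mulnDl.
Qed.

Lemma whomogX (i : 'I_m) : odd_whomog (2 * i + 3) ('X_i : {mpoly rat[m]}).
Proof.
move=> a; rewrite msuppX inE => /eqP ->.
rewrite (bigD1 i) //= mnm1E eqxx mul1n big1 ?addn0 // => j ji.
by rewrite mnm1E eq_sym (negPf ji).
Qed.

Lemma whomog1 : odd_whomog 0 (1 : {mpoly rat[m]}).
Proof. by move=> a; rewrite msupp1 inE => /eqP ->; rewrite big1 // => i _; rewrite mnm0E. Qed.

Lemma whomog0 d : odd_whomog d (0 : {mpoly rat[m]}).
Proof. by move=> a; rewrite msupp0. Qed.

End WeightedHomogeneous.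

(** Substituting -x_(k+1) / (k + 1) for e_k turns the sum into a polynomial [h] of weight d. If [h]
    is non-zero, the conjecture applies; if it is zero, undoing the substitution makes the sum
    vanish in every commutative algebra, in particular in Lambda at u_k = e_k. *)
Lemma conjecture_monomials (s : seq (rat * seq nat)) d :
  bernoulli_conjecture ->
  all (fun x => [&& 0%N \notin x.2, ~~ has odd x.2 & Hdeg x.2 == d]) s ->
  (forall (A : comAlgType rat) (u : nat -> A),
     \sum_(x <- s) x.1 *: \prod_(k <- x.2) u k = 0) \/
  (forall N, exists p, [/\ prime p, (N < p)%N &
     ~~ (p%:Z %| numq (\sum_(x <- s) x.1 *
          \prod_(k <- x.2) - (bernoulli (p - k.+1) / k.+1%:R)))%Z]).
Proof.
move=> BC sP.
(* An even index k = 2i + 2 corresponds to the variable 'X_i of weight 2i + 3 = k + 1. Since k < d,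
   d + 1 variables suffice, and their number is positive. *)
have kP x k : x \in s -> k \in x.2 -> exists2 i : 'I_d.+1, k = (2 * i).+2 & inord k./2.-1 = i.
  move=> /(allP sP)/and3P[x0 /hasPn xo /eqP xd] kx.
  have k0 : k != 0%N by apply: contraNneq x0 => <-.
  have k2 := odd_double_half k; rewrite (negPf (xo k kx)) add0n in k2.
  have kd : (k.+1 <= d)%N.
    by rewrite -xd /Hdeg (perm_big _ (perm_to_rem kx)) big_cons leq_addr.
  exists (inord k./2.-1) => //; rewrite inordK; last by lia.
  by lia.
pose c k : rat := - k.+1%:R^-1.
pose X (k : nat) : {mpoly rat[d.+1]} := 'X_(inord k./2.-1).
pose h := \sum_(x <- s) (x.1 * \prod_(k <- x.2) c k) *: \prod_(k <- x.2) X k.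
have hd : odd_whomog d h.
  rewrite /h big_seq; apply: (big_ind (odd_whomog d)); [exact: whomog0|exact: whomogD|].
  move=> x xs; apply: whomogZ; have /(allP sP)/and3P[_ _ /eqP xd] := xs.
  rewrite -[X in odd_whomog X _]xd.
  rewrite /Hdeg big_seq [X in odd_whomog _ X]big_seq.
  apply: (big_rec2 (fun e q => odd_whomog e q)); first exact: whomog1.
  move=> k e q /(kP x k xs)[i kE iE] eq_; apply: whomogM => //.
  by rewrite /X iE kE -addn3; exact: whomogX.
have [h0|h0] := eqVneq h 0; [left => A u | right => N].
  (* Inverse of the scaling by [c]: the factor is -(k + 1) for k = 2i + 2. *)
  pose v (i : 'I_d.+1) : A := - (2 * i + 3)%:R *: u (2 * i).+2.
  have := congr1 (mmap (in_alg A) v) h0; rewrite raddf0 /h raddf_sum /= => E.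
  rewrite -[RHS]E big_seq [RHS]big_seq; apply: eq_bigr => x xs.
  rewrite mmapZ rmorph_prod /= -scalerAl mul1r -scalerA; congr (_ *: _).
  rewrite -scaler_prod big_seq [RHS]big_seq; apply: eq_bigr => k /(kP x k xs)[i kE iE].
  rewrite /X iE mmapX mmap1U /v scalerA /c kE.
  by rewrite (_ : _ * _ = 1) ?scale1r // mulrNN addn3 mulVf ?pnatr_eq0.
have [p [pp Np pB]] := BC _ h isT h0 (ex_intro _ d hd) N; exists p; split=> //.
apply: contra pB; rewrite /h raddf_sum /=.
suff -> : \sum_(x <- s) x.1 * \prod_(k <- x.2) - (bernoulli (p - k.+1) / k.+1%:R) =
  \sum_(x <- s) ((x.1 * \prod_(k <- x.2) c k) *: \prod_(k <- x.2) X k).@[fun i : 'I_d.+1 =>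
    bernoulli (p - (2 * i + 3))] by [].
rewrite big_seq [RHS]big_seq; apply: eq_bigr => x xs.
rewrite mevalZ rmorph_prod -mulrA -big_split /=; congr (_ * _).
rewrite big_seq [RHS]big_seq; apply: eq_bigr => k /(kP x k xs)[i kE iE].
by rewrite /X iE mevalXU /c kE -addn3 mulrC mulNr mulrC.
Qed.

End MonomialSums.

From mathcomp Require Import generic_quotient ring_quotient.
From mathcomp Require Import finmap monalg.
From mathcomp Require Import all_classical topology.

Local Open Scope classical_set_scope.
Local Open Scope ring_scope.

(** * Evaluation of symmetric functions *)

Local Notation "x * y" := (mmul x y) : monom_scope.

Section Evaluation.
Variable s : seq rat.
Implicit Types (m : {cmonom nat}) (f g : symfun) (d : nat).
Let n := size s.

Definition cmeval m : rat := \prod_(i <- finsupp m) s`_i ^+ m i.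

Lemma big_finsupp (T : Type) (idx : T) (op : Monoid.com_law idx)
    (F : nat -> nat -> T) k m :
  (forall i, F i 0%N = idx) -> (forall i, (k <= i)%N -> m i = 0%N) ->
  \big[op/idx]_(i <- finsupp m) F i (m i) = \big[op/idx]_(i < k) F i (m i).
Proof.
move=> F0 mk; rewrite -(big_mkord xpredT (fun i => F i (m i))).
rewrite [RHS](bigID (fun i => m i != 0%N)) /= [X in _ = op _ X]big1 ?Monoid.mulm1; last first.
  by move=> i /negPn/eqP ->.
rewrite -[RHS]big_filter; apply: perm_big; apply: uniq_perm.
- exact: fset_uniq.
- by rewrite filter_uniq // iota_uniq.
move=> i; rewrite mem_filter mem_index_iota /= -cmE_neq0.
by have [//|mi /=] := eqVneq (m i) 0%N; case: ltnP => // /mk mi0; rewrite mi0 eqxx in mi.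
Qed.

Lemma cmeval_ord k m : (forall i, (k <= i)%N -> m i = 0%N) ->
  cmeval m = \prod_(i < k) s`_i ^+ m i.
Proof.
by move=> mk; rewrite /cmeval (@big_finsupp _ _ _ (fun i j => s`_i ^+ j) k).
Qed.

Lemma cm_bounded_support m : exists k, forall i, (k <= i)%N -> m i = 0%N.
Proof.
exists (\max_(i <- finsupp m) i.+1)%N => i ki; apply/eqP; rewrite cmE_eq0.
apply: contraTN ki => im; rewrite -ltnNge.
by rewrite (big_fsetD1 _ im) /= leq_max ltnSn.
Qed.

Lemma cmevalM a b : cmeval (a * b)%M = cmeval a * cmeval b.
Proof.
have [ka ha] := cm_bounded_support a; have [kb hb] := cm_bounded_support b.
rewrite !(@cmeval_ord (maxn ka kb)).
- by rewrite -big_split /=; apply: eq_bigr => i _; rewrite cmM exprD.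
- by move=> i; rewrite geq_max => /andP[_ /hb].
- by move=> i; rewrite geq_max => /andP[/ha].
- by move=> i; rewrite geq_max cmM => /andP[/ha-> /hb->].
Qed.

Lemma cmeval_neq0 m i : cmeval m != 0 -> (n <= i)%N -> m i = 0%N.
Proof.
move=> m0 ni; apply/eqP; apply: contraNT m0; rewrite cmE_neq0 => im.
by rewrite /cmeval (big_fsetD1 _ im) /= nth_default // expr0n cmE_eq0 im mul0r.
Qed.

(** Bounding each exponent, not the total degree, makes the monomials a full set of functions, the
    index set of an expanded product of sums; this is what [seval_elem] exploits. Monomials using a
    variable beyond the list have value 0. *)
Definition cmbox d (h : {ffun 'I_n -> 'I_d.+1}) : {cmonom nat} :=
  [cmonom (if insub i is Some j then nat_of_ord (h j) else 0)%N
     | i in [fset j in iota 0 n]%fset]%M.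

Lemma cmboxE d (h : {ffun 'I_n -> 'I_d.+1}) i :
  cmbox h i = if insub i is Some j then nat_of_ord (h j) else 0%N.
Proof.
rewrite cmE fsfun_fun !inE /= mem_iota /=; case: ifP => // /negbT ni.
by rewrite insubN.
Qed.

Lemma cmbox_ord d (h : {ffun 'I_n -> 'I_d.+1}) (i : 'I_n) : cmbox h i = h i.
Proof. by rewrite cmboxE valK. Qed.

Lemma cmbox_ge d (h : {ffun 'I_n -> 'I_d.+1}) i : (n <= i)%N -> cmbox h i = 0%N.
Proof. by move=> ni; rewrite cmboxE insubN // -leqNgt. Qed.

Lemma cmbox_inj d : injective (@cmbox d).
Proof.
move=> h h' /eqP/cmP e; apply/ffunP => i; apply: val_inj.
by rewrite /= -!cmbox_ord.
Qed.

Definition cmboxes d : seq {cmonom nat} := [seq cmbox h | h : {ffun 'I_n -> 'I_d.+1}].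

Lemma cmboxes_uniq d : uniq (cmboxes d).
Proof. by rewrite map_inj_uniq ?enum_uniq //; exact: cmbox_inj. Qed.

Lemma mem_cmboxes d m :
  (forall i, (m i <= d)%N) -> (forall i, (n <= i)%N -> m i = 0%N) -> m \in cmboxes d.
Proof.
move=> md mn; apply/mapP; exists [ffun i : 'I_n => inord (m i)]; first by rewrite mem_enum.
apply/eqP/cmP => i; have [ni|ni] := leqP n i; first by rewrite cmbox_ge ?mn.
by rewrite -[i]/(val (Ordinal ni)) cmbox_ord ffunE inordK // ltnS.
Qed.

Lemma cmboxesP d m : m \in cmboxes d -> forall i, (m i <= d)%N /\ ((n <= i)%N -> m i = 0%N).
Proof.
move=> /mapP[h _ ->] i; split; last exact: cmbox_ge.
have [ni|ni] := leqP n i; first by rewrite cmbox_ge.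
by rewrite -[i]/(val (Ordinal ni)) cmbox_ord -ltnS.
Qed.

Lemma seval_boxes d f :
  (forall m i, symfun_val f m != 0 -> (m i <= d)%N) ->
  seval f s = \sum_(m <- cmboxes d) symfun_val f m * cmeval m.
Proof.
move=> fd; rewrite /seval -(fsbig_widen [set` cmboxes d]) //=; last first.
  move=> m /= [_ mN]; apply/eqP; apply: contra_notT mN.
  rewrite mulf_eq0 negb_or => /andP[fm wm]; apply: mem_cmboxes.
    by move=> i; exact: fd.
  by move=> i; exact: cmeval_neq0.
by rewrite -fsbig_seq ?cmboxes_uniq.
Qed.

Lemma symfun_bounded f :
  exists d, forall d' m, (d <= d')%N -> symfun_val f m != 0 -> (mdeg m <= d')%N.
Proof.
have /asboolP[[d fd] _] := symfun_valP f.
by exists d => d' m dd' /fd md; exact: leq_trans dd'.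
Qed.

Lemma sevalD f g : seval (f + g) s = seval f s + seval g s.
Proof.
have [d fd] := symfun_bounded f; have [e ge] := symfun_bounded g.
have hf m i : symfun_val f m != 0 -> (m i <= maxn d e)%N.
  by move=> /(fd _ _ (leq_maxl d e)); apply: leq_trans; exact: cm_le_mdeg.
have hg m i : symfun_val g m != 0 -> (m i <= maxn d e)%N.
  by move=> /(ge _ _ (leq_maxr d e)); apply: leq_trans; exact: cm_le_mdeg.
have E m : symfun_val (f + g) m = symfun_val f m + symfun_val g m by [].
rewrite (seval_boxes hf) (seval_boxes hg) (@seval_boxes (maxn d e)).
  by rewrite -big_split; apply: eq_bigr => m _; rewrite E mulrDl.
move=> m i; rewrite E.
have [-> |/hf-> //] := eqVneq (symfun_val f m) 0.
by rewrite add0r => /hg.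
Qed.

Lemma sevalZ c f : seval (c *: f) s = c * seval f s.
Proof.
have [d fd] := symfun_bounded f.
have hf m i : symfun_val f m != 0 -> (m i <= d)%N.
  by move=> /(fd _ _ (leqnn d)); apply: leq_trans; exact: cm_le_mdeg.
have E m : symfun_val (c *: f) m = c * symfun_val f m by [].
rewrite (seval_boxes hf) (@seval_boxes d).
  by rewrite big_distrr; apply: eq_bigr => m _; rewrite E -mulrA.
by move=> m i; rewrite E mulf_eq0 negb_or => /andP[_ /hf].
Qed.

(** Both sides sum the same terms over pairs of monomials (a, b): once grouped by the product a b,
    once over two boxes. The two lists of pairs agree where the term is non-zero. *)
Lemma sevalM f g : seval (f * g) s = seval f s * seval g s.
Proof.
have [d fd] := symfun_bounded f; have [e ge] := symfun_bounded g.
have hf m i : symfun_val f m != 0 -> (m i <= d)%N.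
  by move=> /(fd _ _ (leqnn d)); apply: leq_trans; exact: cm_le_mdeg.
have hg m i : symfun_val g m != 0 -> (m i <= e)%N.
  by move=> /(ge _ _ (leqnn e)); apply: leq_trans; exact: cm_le_mdeg.
have E m : symfun_val (f * g) m =
    \sum_(x <- decs m) symfun_val f x.1 * symfun_val g x.2 by exact: powser_mulE.
rewrite (seval_boxes hf) (seval_boxes hg) (@seval_boxes (d + e)); last first.
  move=> m i; apply: contraNT; rewrite -ltnNge => mi; apply/eqP.
  rewrite E big_seq big1 // => x; rewrite mem_decs => /eqP xm.
  apply/eqP; apply: contraTT mi; rewrite mulf_eq0 negb_or => /andP[/hf f1 /hg g2].
  by rewrite -leqNgt -xm cmM leq_add.
pose F (x : {cmonom nat} * {cmonom nat}) : rat :=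
  (symfun_val f x.1 * cmeval x.1) * (symfun_val g x.2 * cmeval x.2).
rewrite big_distrlr.
transitivity (\sum_(x <- [seq x | m <- cmboxes (d + e), x <- decs m]) F x).
  rewrite big_allpairs_dep; apply: eq_bigr => m _.
  rewrite E big_distrl big_seq [RHS]big_seq; apply: eq_bigr => x /=.
  by rewrite mem_decs => /eqP <-; rewrite cmevalM /F; ring.
transitivity (\sum_(x <- [seq (a, b) | a <- cmboxes d, b <- cmboxes e]) F x); last first.
  by rewrite big_allpairs_dep.
rewrite (bigID (fun x => F x != 0)) [RHS](bigID (fun x => F x != 0)) /=.
rewrite [X in _ + X]big1 ?addr0; last by move=> x /negPn/eqP.
rewrite [X in _ = _ + X]big1 ?addr0; last by move=> x /negPn/eqP.
rewrite -big_filter -[RHS]big_filter; apply: perm_big; apply: uniq_perm.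
- rewrite filter_uniq //; apply: allpairs_uniq_dep; first exact: cmboxes_uniq.
    by move=> *; exact: decs_uniq.
  move=> [m x] [m' x'] /allpairsPdep[m1 [x1 [_ + e1]]] /allpairsPdep[m2 [x2 [_ + e2]]] /= xx.
  case: e1 => <- <-; case: e2 => <- <-; rewrite !mem_decs => /eqP <- /eqP <-.
  by rewrite xx.
- by rewrite filter_uniq //; apply: allpairs_uniq; rewrite ?cmboxes_uniq // => -[? ?] [? ?] _ _.
move=> [a b]; rewrite !mem_filter; case: eqP => //= /eqP.
rewrite !mulf_eq0 !negb_or /= => /andP[/andP[fa wa] /andP[gb wb]].
transitivity true; last first.
  apply/esym/allpairsP; exists (a, b); split => //=; apply: mem_cmboxes => i.
  - exact: hf.
  - exact: cmeval_neq0.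
  - exact: hg.
  - exact: cmeval_neq0.
apply/allpairsPdep; exists (a * b)%M, (a, b); split => //; last by rewrite mem_decs.
apply: mem_cmboxes => i; first by rewrite cmM leq_add ?hf ?hg.
by move=> ni; rewrite cmM !cmeval_neq0.
Qed.

(** With exponents at most 1 the box indexes the terms of the expanded product of the 1 + s_i X, and
    its monomials are squarefree; the condition on the degree selects the coefficient of X^k. *)
Lemma seval_elem k : seval (elem k) s = elem_val s k.
Proof.
have E m : symfun_val (elem k) m =
  ((mdeg m == k) && all (fun i => m i == 1%N) (finsupp m))%:R by [].
rewrite (@seval_boxes 1); last first.
  move=> m i; rewrite E; case: allP; last by rewrite andbF eqxx.
  move=> m1 _; have [/m1/eqP-> //|] := boolP (i \in finsupp m).
  by rewrite -cmE_eq0 => /eqP ->.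
rewrite big_map /elem_val.
transitivity ((\prod_(i < n) \sum_(j < 2) (s`_i *: 'X) ^+ j : {poly rat})`_k); last first.
  rewrite [in RHS](big_nth 0) [in RHS]big_mkord; congr (nth 0 (polyseq _) k).
  by apply: eq_bigr => i _; rewrite !big_ord_recl big_ord0 addr0.
rewrite bigA_distr_bigA coef_sum big_enum; apply: eq_big => [h|h _] //.
rewrite E; have -> : all (fun i => cmbox h i == 1%N) (finsupp (cmbox h)).
  apply/allP => i; rewrite -cmE_neq0 => hi.
  by have [+ _] := cmboxesP (map_f (@cmbox 1) (mem_enum predT h)) i; case: (cmbox h i) hi => [|[]].
rewrite andbT (@cmeval_ord n); last by move=> i; exact: cmbox_ge.
under [in RHS]eq_bigr => i _ do rewrite exprZn.
rewrite scaler_prod coefZ -expr_sum coefXn mulrC.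
congr (_ * _); first by apply: eq_bigr => i _; rewrite cmbox_ord.
rewrite mdegE (@big_finsupp _ _ _ (fun _ j => j) n) //; last first.
  by move=> i; exact: cmbox_ge.
rewrite eq_sym (_ : (\sum_(i < n) cmbox h i = \sum_(i < n) h i)%N) //.
by apply: eq_bigr => i _; rewrite cmbox_ord.
Qed.

Lemma seval1 : seval 1 s = 1.
Proof.
rewrite -elem0 seval_elem /elem_val -horner_coef0 horner_prod big1 // => a _.
by rewrite !hornerE.
Qed.

Lemma seval0 : seval 0 s = 0.
Proof. by rewrite -(scale0r 0) sevalZ mul0r. Qed.

Lemma seval_sum (I : Type) (r : seq I) (P : pred I) (F : I -> symfun) :
  seval (\sum_(i <- r | P i) F i) s = \sum_(i <- r | P i) seval (F i) s.
Proof. exact: (big_morph (fun f => seval f s) sevalD seval0). Qed.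

Lemma seval_prod (I : Type) (r : seq I) (P : pred I) (F : I -> symfun) :
  seval (\prod_(i <- r | P i) F i) s = \prod_(i <- r | P i) seval (F i) s.
Proof. exact: (big_morph (fun f => seval f s) sevalM seval1). Qed.

End Evaluation.

(** * The kernel as an ideal *)

Definition large_primes (P : nat -> Prop) : Prop :=
  exists N, forall p, prime p -> (N < p)%N -> P p.

Section LargePrimes.
Implicit Types P Q : nat -> Prop.

Lemma large_primesI P Q (R : nat -> Prop) :
  (forall p, prime p -> P p -> Q p -> R p) ->
  large_primes P -> large_primes Q -> large_primes R.
Proof.
move=> PQR [N NP] [M MQ]; exists (maxn N M) => p pp; rewrite gtn_max => /andP[Np Mp].
by apply: PQR => //; [exact: NP | exact: MQ].
Qed.

Lemma large_primesW P Q :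
  (forall p, prime p -> P p -> Q p) -> large_primes P -> large_primes Q.
Proof. by move=> PQ [N NP]; exists N => p pp Np; apply: PQ => //; exact: NP. Qed.

Lemma large_primes_gt N : large_primes (fun p => (N < p)%N).
Proof. by exists N. Qed.

Lemma large_primesT P : (forall p, prime p -> P p) -> large_primes P.
Proof. by move=> HP; exists 0%N => p pp _; exact: HP. Qed.

Lemma large_primes_sum (n : nat) (I : eqType) (r : seq I) (C : pred I)
    (F : I -> nat -> rat) :
  (forall i, i \in r -> C i -> large_primes (fun p => pdvd p n (F i p))) ->
  large_primes (fun p => pdvd p n (\sum_(i <- r | C i) F i p)).
Proof.
elim: r => [_|i r IH Fr].
  by apply: large_primesT => p pp; rewrite big_nil; exact: pdvd0.
have /IH {}IH : forall j, j \in r -> C j -> large_primes (fun p => pdvd p n (F j p)).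
  by move=> j jr; apply: Fr; rewrite inE jr orbT.
have [Ci|Ci] := boolP (C i); last first.
  by apply: large_primesW IH => p pp; rewrite big_cons (negPf Ci).
apply: large_primesI IH (Fr i (mem_head _ _) Ci) => p pp h1 h2.
by rewrite big_cons Ci; exact: pdvdD.
Qed.

Lemma large_primes_pint (q : rat) : large_primes (fun p => pdvd p 0 q).
Proof.
exists `|denq q|%N => p pp qp; exists (numq q), (denq q); split.
  by rewrite dvdzE /= gtnNdvd // absz_gt0 denq_neq0.
by rewrite -{1}(divq_num_den q) divfK ?intr_eq0 ?denq_neq0 // mul1r.
Qed.

End LargePrimes.

Definition Sval (p : nat) (f : symfun) : rat := seval f (plist p).

Lemma large_primes_prod_elem (l : seq nat) : 0%N \notin l ->
  large_primes (fun p => pdvd p (Hdeg l) (\prod_(k <- l) elem_val (plist p) k)).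
Proof.
elim: l => [_|k l IH].
  by apply: large_primesT => p pp; rewrite /Hdeg !big_nil; exact: (pint_nat pp 1).
rewrite inE negb_or eq_sym -lt0n => /andP[k0 /IH {}IH].
apply: large_primesI IH (large_primes_gt k.+2) => p pp h kp.
rewrite /Hdeg !big_cons; apply: pdvdM => //; apply: pdvd_elem_valS => //; lia.
Qed.

Lemma Sval_monomial p (s : seq (rat * seq nat)) (C : pred (rat * seq nat)) :
  Sval p (\sum_(x <- s | C x) x.1 *: \prod_(k <- x.2) elem k) =
  \sum_(x <- s | C x) x.1 * \prod_(k <- x.2) elem_val (plist p) k.
Proof.
rewrite /Sval seval_sum; apply: eq_bigr => x _; rewrite sevalZ seval_prod.
by congr (_ * _); apply: eq_bigr => k _; exact: seval_elem.
Qed.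

(** Each e_k in a monomial contributes p^(k+1), and the coefficients are p-integral for large p.
    This is why Z^[n] vanishes on I_n. *)
Lemma large_primes_Hhomog m f : Hhomog m f -> large_primes (fun p => pdvd p m (Sval p f)).
Proof.
move=> [s sP ->]; have := @large_primes_sum m _ s xpredT
  (fun x p => x.1 * \prod_(k <- x.2) elem_val (plist p) k).
move=> H; apply: large_primesW (H _) => [p pp|x /(allP sP)/andP[x0 /eqP <-] _].
  by rewrite Sval_monomial.
apply: large_primesI (large_primes_pint x.1) (large_primes_prod_elem x0) => p pp h1 h2.
exact: pdvdMl.
Qed.

Definition trunc_hat (n : nat) (f : Lhat) : symfun := \sum_(m < n) f m.

Lemma Sval_trunc p n (f : Lhat) : Sval p (trunc_hat n f) = \sum_(m < n) Sval p (f m).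
Proof. exact: seval_sum. Qed.

Lemma pint_trunc n (f : Lhat) : large_primes (fun p => pdvd p 0 (Sval p (trunc_hat n f))).
Proof.
have := @large_primes_sum 0 _ (index_enum 'I_n) xpredT (fun (m : 'I_n) p => Sval p (f m)).
move=> H; apply: large_primesW (H _) => [p pp|m _ _]; first by rewrite Sval_trunc.
by apply: large_primesW (large_primes_Hhomog (compP f m)) => p pp; exact: pint.
Qed.

(** * From the quotient rings [calA] to congruences in Z_(p) *)

Lemma Zp_intr_eq0 N (a : int) : (1 < N)%N -> ((a%:~R : 'Z_N) == 0) = (N%:Z %| a)%Z.
Proof.
move=> N1; rewrite dvdzE /= /dvdn -val_Zp_nat //.
case: a => n; rewrite ?NegzE ?mulrNz ?oppr_eq0; by rewrite -pmulrn -val_eqE.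
Qed.

Lemma ratmod_eq0 p n q : prime p -> pdvd p 0 q ->
  (ratmod (p ^ n.+1) q == 0) = ((p ^ n.+1)%N%:Z %| numq q)%Z.
Proof.
move=> pp pq; have N1 : (1 < p ^ n.+1)%N by rewrite -(exp1n n.+1) ltn_exp2r // prime_gt1.
rewrite -Zp_intr_eq0 // /ratmod.
have du : (denq q)%:~R \is a @GRing.unit 'Z_(p ^ n.+1).
  have := pint_denq pp pq; rewrite dvdzE /=; case: (denq q) => d /=.
    by rewrite -pmulrn unitZpE // coprime_pexpl // prime_coprime.
  by rewrite NegzE mulrNz unitrN -pmulrn unitZpE // coprime_pexpl // prime_coprime.
by apply/eqP/eqP => [h|->]; [rewrite -[LHS](divrK du) h mul0r | rewrite mul0r].
Qed.

(** A set of primes is finite exactly when it is bounded, so lying in the direct sum means vanishing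
    at all large primes; there p-integrality makes [ratmod] a genuine reduction. *)
Lemma Zn_eq0 n f : large_primes (fun p => pdvd p 0 (Sval p f)) ->
  Zn n.+1 f = 0 <-> large_primes (fun p => pdvd p n.+1 (Sval p f)).
Proof.
move=> f_int.
have ZE : Zn n.+1 f = 0 <-> Zfamily n.+1 f \in @sumZ n.+1.
  have := @Quotient.idealrBE _ (@sumZ n.+1) (Zfamily n.+1 f) 0.
  rewrite subr0 => ->; rewrite /Zn.
  have -> : 0 = \pi_(calA n.+1)%qT 0 by rewrite raddf0.
  by split=> [->|/eqP].
rewrite ZE; split=> [/asboolP ffin|].
  have /finite_fsetP[X XE] := ffin.
  have H : large_primes (fun p => (\max_(q <- X) sval q < p)%N) by exact: large_primes_gt.
  apply: large_primesI H f_int => p pp Xp pf; apply: pdvd_numq => //.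
  rewrite -ratmod_eq0 //; apply: contraTT Xp => fp.
  have : [set p | Zfamily n.+1 f p != 0] (exist _ p pp) by [].
  rewrite XE /= => pX; rewrite -leqNgt (big_fsetD1 _ pX) /=; exact: leq_maxl.
move=> f_dvd; have [N NP] := large_primesI (R := fun p => ratmod (p ^ n.+1) (Sval p f) = 0)
  (fun p pp h k => eqP (etrans (ratmod_eq0 n pp h) (pdvd_coprime_num pp k))) f_int f_dvd.
(* [h] lists the primes up to N; an index that is not prime is sent to 2. *)
apply/asboolP; pose h (i : 'I_N.+1) : {p : nat | prime p} :=
  insubd (exist _ 2%N isT) (i : nat).
apply: (@sub_finite_set _ _ (h @` setT)).
  move=> [p pp] /= fp; have [pN|Np] := leqP p N; last first.
    by move: fp; rewrite /Zfamily /= [ratmod _ _]NP ?eqxx.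
  have pN' : (p < N.+1)%N by [].
  by exists (Ordinal pN') => //; apply: val_inj; rewrite val_insubd /= pp.
exact/finite_image/finite_finset.
Qed.

(** Level n + 1 here is component n of [Zhat]; level 0 holds for every f. *)
Definition in_ker (f : Lhat) : Prop :=
  forall n, large_primes (fun p => pdvd p n (Sval p (trunc_hat n f))).

Lemma ker_ZhatP f : ker_Zhat f <-> in_ker f.
Proof.
split=> [fK [|n]|fK n]; first exact: pint_trunc.
  by apply/(Zn_eq0 n (pint_trunc _ _)); exact: fK.
by apply/(Zn_eq0 n (pint_trunc _ _)); exact: fK.
Qed.

Lemma trunc_hat0 f : trunc_hat 0 f = 0.
Proof. exact: big_ord0. Qed.

Lemma trunc_hatS n f : trunc_hat n.+1 f = trunc_hat n f + f n.
Proof. exact: big_ord_recr. Qed.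

Lemma trunc_hatD n f g : trunc_hat n (f + g) = trunc_hat n f + trunc_hat n g.
Proof. exact: big_split. Qed.

Lemma compD (f g : Lhat) m : (f + g) m = f m + g m.
Proof. by []. Qed.

Lemma compN (f : Lhat) m : (- f) m = - f m.
Proof. by []. Qed.

Lemma compM (f g : Lhat) m : (f * g) m = \sum_(i < m.+1) f i * g (m - i)%N.
Proof. by []. Qed.

Lemma in_ker0 : in_ker 0.
Proof.
move=> n; apply: large_primesT => p pp; rewrite Sval_trunc big1; first exact: pdvd0.
by move=> m _; exact: seval0.
Qed.

Lemma in_kerD f g : in_ker f -> in_ker g -> in_ker (f + g).
Proof.
move=> fK gK n; apply: large_primesI (fK n) (gK n) => p pp h k.
by rewrite trunc_hatD /Sval sevalD; exact: pdvdD.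
Qed.

Lemma trunc_hatM n f g :
  trunc_hat n (f * g) = \sum_(i < n) f i * trunc_hat (n - i) g.
Proof.
elim: n => [|n IH]; first by rewrite trunc_hat0 big_ord0.
rewrite trunc_hatS IH compM [in RHS]big_ord_recr big_ord_recr /=.
rewrite subSnn subnn trunc_hatS trunc_hat0 add0r addrA; congr (_ + _).
rewrite -big_split; apply: eq_bigr => i _ /=.
by rewrite subSn 1?ltnW // trunc_hatS mulrDr.
Qed.

(** In [trunc_hatM] the factor f_i contributes p^i and the truncation of g below n - i contributes
    p^(n-i). *)
Lemma in_kerM f g : in_ker g -> in_ker (f * g).
Proof.
move=> gK n.
have := @large_primes_sum n _ (index_enum 'I_n) xpredT
  (fun (i : 'I_n) p => Sval p (f i) * Sval p (trunc_hat (n - i) g)).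
move=> H; apply: large_primesW (H _) => [p pp|i _ _].
  rewrite trunc_hatM /Sval seval_sum.
  by under [X in _ -> pdvd _ _ X]eq_bigr => i _ do rewrite sevalM.
apply: large_primesI (large_primes_Hhomog (compP f i)) (gK (n - i)%N) => p pp h k.
by have := pdvdM pp h k; rewrite subnKC // ltnW.
Qed.

Lemma in_kerN f : in_ker f -> in_ker (- f).
Proof. by rewrite -mulN1r; exact: in_kerM. Qed.

(** * The beta_k lie in the kernel *)

Lemma trunc_elem_series c n :
  trunc_hat n.+1 (elem_series c) = c 0%N *: elem 0 + \sum_(1 <= j < n) c j *: elem j.
Proof.
elim: n => [|[|n] IH]; rewrite trunc_hatS.
- by rewrite trunc_hat0 add0r big_geq // addr0.
- by rewrite IH !big_geq //= addr0.
by rewrite IH /= [in RHS]big_nat_recr //= addrA.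
Qed.

(** The terms omitted by the truncation are divisible by p^n. Their number grows with p, so a single
    bound on p must serve them all; integrality of the c_j provides it. *)
Lemma Sval_elem_series c n : (forall j, exists z : int, c j = z%:~R) ->
  large_primes (fun p => pdvd p n (Sval p (trunc_hat n (elem_series c)) -
    \sum_(j < p) c j * elem_val (plist p) j)).
Proof.
move=> cZ; apply: large_primesW (large_primes_gt (n + 2)) => p pp np.
have p2 : (2 < p)%N by lia.
have cint j : pdvd p 0 (c j) by have [z ->] := cZ j; exact: pint_int.
rewrite -opprB; apply: (pdvdN pp); case: n np => [|n] np.
  rewrite trunc_hat0 /Sval seval0 subr0; apply: (pdvd_sum pp) => j _.
  by apply: pdvdMl => //; apply: pint (pdvd_elem_val pp p2 j).
rewrite trunc_elem_series /Sval sevalD sevalZ seval_elem seval_sum.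
rewrite -(big_mkord xpredT (fun j => c j * elem_val (plist p) j)).
rewrite (@big_cat_nat _ _ _ (maxn 1 n)) //=; last by rewrite geq_max; lia.
have -> : \sum_(0 <= j < maxn 1 n) c j * elem_val (plist p) j =
    c 0%N * elem_val (plist p) 0 + \sum_(1 <= j < n) seval (c j *: elem j) (plist p).
  rewrite big_ltn ?leq_max //; congr (_ + _).
  rewrite (_ : \sum_(1 <= j < maxn 1 n) _ = \sum_(1 <= j < n) c j * elem_val (plist p) j).
    by apply: eq_bigr => j _; rewrite sevalZ seval_elem.
  by case: n {np} => [|[|n]] //; rewrite ?(maxn_idPl _) // !big_geq.
rewrite addrAC subrr add0r big_nat; apply: (pdvd_sum pp) => j /andP[nj jp].
apply: pdvdMl => //; move: nj; rewrite geq_max => /andP[j0 nj].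
(* For j > n the power p^j is enough, also at j = p - 1; only j = n calls for the extra factor p. *)
have [jn|jn] := eqVneq j n; last first.
  by apply: pdvd_le (pdvd_elem_val pp p2 j); lia.
by rewrite -jn; apply: pdvd_elem_valS => //; lia.
Qed.

(** The sum over all j < p is exactly 0 by [elem_val_reflection]; truncation costs only multiples of
    p^n. *)
Lemma in_ker_beta k : in_ker (beta k).
Proof.
move=> n.
have c1Z j : exists z : int, (if j == k then 1 else 0) = z%:~R :> rat.
  by case: eqP; [exists 1 | exists 0].
have c2Z j : exists z : int,
    (if (k <= j)%N then (-1) ^+ j.+1 * 'C(j, k)%:R else 0) = z%:~R :> rat.
  case: ifP; last by exists 0.
  by exists ((-1) ^+ j.+1 * 'C(j, k)%:Z); rewrite rmorphM rmorph_sign.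
have H1 := large_primesI (fun p pp => @pdvdD p pp n _ _)
  (Sval_elem_series n c1Z) (Sval_elem_series n c2Z).
apply: large_primesI H1 (large_primes_gt (k + 2)) => p pp + kp.
have p2 : (2 < p)%N by lia.
rewrite trunc_hatD /Sval sevalD addrACA -opprD.
set X := (X in _ - X); suff -> : X = 0 by rewrite subr0.
rewrite /X -big_split /=.
have kp' : (k < p)%N by lia.
transitivity (elem_val (plist p) k -
    \sum_(j < p) (-1) ^+ j * 'C(j, k)%:R * elem_val (plist p) j); last first.
  by rewrite -elem_val_reflection // subrr.
rewrite big_split /=; congr (_ + _).
  rewrite (bigD1 (Ordinal kp')) //= eqxx mul1r big1 ?addr0 // => j jk.
  rewrite ifF ?mul0r //; apply/negP => /eqP e; case/eqP: jk; exact: val_inj.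
rewrite -sumrN; apply: eq_bigr => j _; case: leqP => [kj|jk].
  by rewrite exprS mulN1r !mulNr.
by rewrite bin_small // mulr0 !mul0r oppr0.
Qed.

(** * Approximating kernel elements in the ideal *)

Lemma I_beta0 : I_beta 0.
Proof. by exists [::]; rewrite big_nil. Qed.

Lemma I_betaD f g : I_beta f -> I_beta g -> I_beta (f + g).
Proof. by move=> [s ->] [t ->]; exists (s ++ t); rewrite big_cat. Qed.

Lemma I_beta_gen f k : I_beta (f * beta k).
Proof. by exists [:: (f, k)]; rewrite big_seq1. Qed.

Lemma in_ker_I_beta f : I_beta f -> in_ker f.
Proof.
move=> [s ->]; apply: big_ind => [||x _]; [exact: in_ker0 | exact: in_kerD |].
by apply: in_kerM; exact: in_ker_beta.
Qed.

(** Level n of [in_ker] depends only on the components below n, which f shares with some element of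
    the ideal. *)
Lemma closure_sub_ker : closure I_beta `<=` ker_Zhat.
Proof.
move=> f fC; apply/ker_ZhatP => n.
have /fC[g [gI gf]] : nbhs f [set g : Lhat | forall m, (m < n)%N -> g m = f m].
  by exists n.
have -> : trunc_hat n f = trunc_hat n g.
  by apply: eq_bigr => m _; rewrite gf.
exact: in_ker_I_beta.
Qed.

Section Homogeneous.
Variables (d : nat) (f : symfun).
Hypothesis fd : Hhomog d f.

Fact homog_hat_subproof m : Hhomog m (if m == d then f else 0).
Proof. by case: eqP => [->|_] //; exact: Hhomog0. Qed.

Definition homog_hat : Lhat := MkLhat homog_hat_subproof.

Lemma homog_hatM g m : (homog_hat * g) m = if (d <= m)%N then f * g (m - d)%N else 0.
Proof.
rewrite compM /=; case: leqP => [dm|md].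
  have dm' : (d < m.+1)%N by [].
  rewrite (bigD1 (Ordinal dm')) //= eqxx big1 ?addr0 // => i id.
  rewrite ifF ?mul0r //; apply/negP => /eqP e; case/eqP: id; exact: val_inj.
rewrite big1 // => i _; rewrite ifF ?mul0r //; apply/negP => /eqP e.
by have := ltn_ord i; rewrite e ltnNge md.
Qed.

End Homogeneous.

Lemma beta_lt k m : (0 < k)%N -> (m < k.+1)%N -> beta k m = 0.
Proof.
move=> k0; rewrite /beta compD; case: m => [|[|j]] /= jk.
- by rewrite eq_sym (negPf (lt0n_neq0 k0)) leqNgt k0 !scale0r addr0.
- by rewrite addr0.
rewrite ltnS in jk.
by rewrite (ltn_eqF jk) [(k <= _)%N]leqNgt jk !scale0r addr0.
Qed.

(** The series contributes (-1)^(k+1) e_k, which doubles e_k for odd k but would cancel it for even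
    k; hence only monomials with an odd index are reached below. *)
Lemma beta_odd_lead k : odd k -> beta k k.+1 = 2%:R *: elem k.
Proof.
case: k => [//|k] kodd.
have sgn : (-1) ^+ k.+2 = 1 :> rat by rewrite -signr_odd oddS kodd.
by rewrite /beta compD /= eqxx leqnn binn mulr1 sgn -scalerDl.
Qed.

(** One factor e_k with k odd is replaced by beta_k / 2, which agrees with it in lowest H-degree. *)
Lemma reduce_odd_monomial c l : 0%N \notin l -> has odd l ->
  exists h : Lhat, [/\ I_beta h, forall m, (m < Hdeg l)%N -> h m = 0 &
    h (Hdeg l) = c *: \prod_(k <- l) elem k].
Proof.
move=> l0 /hasP[k kl kodd].
have k0 : (0 < k)%N by rewrite lt0n; apply: contraTneq kodd => ->.
have remH : Hhomog (Hdeg (rem k l)) ((c / 2%:R) *: \prod_(i <- rem k l) elem i).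
  exists [:: (c / 2%:R, rem k l)]; last by rewrite big_seq1.
  by rewrite /= eqxx !andbT; apply: contra l0; exact: mem_rem.
have lE : Hdeg l = (Hdeg (rem k l) + k.+1)%N.
  by rewrite /Hdeg (perm_big _ (perm_to_rem kl)) big_cons addnC.
exists (homog_hat remH * beta k); split; first exact: I_beta_gen.
  move=> m ml; rewrite homog_hatM; case: ifP => // rm.
  by rewrite beta_lt ?mulr0 //; lia.
rewrite homog_hatM lE leq_addr addKn beta_odd_lead // -scalerAl -scalerAr scalerA.
by rewrite divfK ?pnatr_eq0 // (perm_big _ (perm_to_rem kl)) big_cons mulrC.
Qed.

Lemma reduce_odd n (s : seq (rat * seq nat)) :
  all (fun x => (0%N \notin x.2) && (Hdeg x.2 == n)) s ->
  exists h : Lhat, [/\ I_beta h, forall m, (m < n)%N -> h m = 0 &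
    h n = \sum_(x <- s | has odd x.2) x.1 *: \prod_(k <- x.2) elem k].
Proof.
elim: s => [_|x s IH /= /andP[/andP[x0 /eqP xn] /IH[h [hI hlt hn]]]].
  by exists 0; split; rewrite ?big_nil //; exact: I_beta0.
have [xo|xo] := boolP (has odd x.2); last first.
  by exists h; split => //; rewrite big_cons (negPf xo).
have [g [gI glt gn]] := reduce_odd_monomial x.1 x0 xo; rewrite xn in glt gn.
exists (g + h); split; first exact: I_betaD.
  by move=> m mn; rewrite compD glt // hlt // addr0.
by rewrite compD big_cons xo gn hn.
Qed.

Lemma pdvd_pfactor p n m q : prime p ->
  pdvd p (n + m) (p%:R ^+ n * q) -> pdvd p m q.
Proof.
move=> pp [a [b [pb qb]]]; exists a, b; split => //.
have p0 : p%:R ^+ n != 0 :> rat by rewrite expf_neq0 // pnatr_eq0 -lt0n prime_gt0.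
by apply: (mulfI p0); rewrite mulrA qb expnD natrM natrX mulrA.
Qed.

(** Induction on the factors by x y - x' y' = x (y - y') + (x - x') y': each summand pairs a factor
    of full p-order with an error of one order more. *)
Lemma prod_elem_bernoulli (l : seq nat) : 0%N \notin l -> ~~ has odd l ->
  large_primes (fun p => pdvd p (Hdeg l).+1
    (\prod_(k <- l) elem_val (plist p) k -
     p%:R ^+ Hdeg l * \prod_(k <- l) - (bernoulli (p - k.+1) / k.+1%:R))).
Proof.
elim: l => [_ _|k l IH].
  by apply: large_primesT => p pp; rewrite /Hdeg !big_nil mulr1 subrr; exact: pdvd0.
rewrite inE negb_or eq_sym -lt0n /= => /andP[k0 l0] /norP[ke lo].
apply: large_primesI (IH l0 lo) (large_primes_gt (k + Hdeg l + 2)) => p pp h kp.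
have p2 : (2 < p)%N by lia.
pose b k := - (bernoulli (p - k.+1) / k.+1%:R).
have bint i : (i \in l) -> pdvd p 0 (b i).
  move=> il; have i0 : (0 < i)%N by rewrite lt0n; apply: contraNneq l0 => <-.
  have ip : (i < Hdeg l)%N.
    by rewrite /Hdeg (perm_big _ (perm_to_rem il)) big_cons leq_addr.
  apply: (pdvdN pp); apply: pdvdMl => //; first by apply: pint_bernoulli => //; lia.
  by apply: pint_natV => //; lia.
have Bint : pdvd p 0 (\prod_(i <- l) b i).
  rewrite big_seq; apply: (big_ind (pdvd p 0)) => //; first exact: (pint_nat pp 1).
  by move=> x y; exact: pdvdMl.
rewrite {1 2}/Hdeg !big_cons -/(Hdeg l).
have -> : elem_val (plist p) k * \prod_(j <- l) elem_val (plist p) j -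
   p%:R ^+ (k.+1 + Hdeg l) * (b k * \prod_(j <- l) b j) =
   elem_val (plist p) k * (\prod_(j <- l) elem_val (plist p) j -
     p%:R ^+ Hdeg l * \prod_(j <- l) b j) +
   (elem_val (plist p) k - p%:R ^+ k.+1 * b k) * (p%:R ^+ Hdeg l * \prod_(j <- l) b j).
  by rewrite exprD; ring.
apply: (pdvdD pp).
  by rewrite -addnS; apply: pdvdM => //; apply: pdvd_elem_valS => //; lia.
rewrite -addSn; apply: pdvdM => //; first by apply: elem_val_bernoulli => //; lia.
by apply: pdvdMr => //; exact: pdvd_exp.
Qed.

Lemma even_part_eq0 n (s : seq (rat * seq nat)) : bernoulli_conjecture ->
  all (fun x => (0%N \notin x.2) && (Hdeg x.2 == n)) s ->
  large_primes (fun p => pdvd p n.+1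
    (Sval p (\sum_(x <- s | ~~ has odd x.2) x.1 *: \prod_(k <- x.2) elem k))) ->
  \sum_(x <- s | ~~ has odd x.2) x.1 *: \prod_(k <- x.2) elem k = 0.
Proof.
move=> BC sP; pose t := [seq x <- s | ~~ has odd x.2].
have -> : \sum_(x <- s | ~~ has odd x.2) x.1 *: \prod_(k <- x.2) elem k =
    \sum_(x <- t) x.1 *: \prod_(k <- x.2) elem k by rewrite big_filter.
have tP : all (fun x => [&& 0%N \notin x.2, ~~ has odd x.2 & Hdeg x.2 == n]) t.
  apply/allP => x; rewrite mem_filter => /andP[xo xs].
  by have /andP[-> ->] := allP sP x xs; rewrite xo.
have [t0 _|tB] := conjecture_monomials BC tP; first exact: (t0 _ elem).
move=> tdvd.
have := @large_primes_sum n.+1 _ t xpredT (fun x p =>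
   x.1 * (\prod_(k <- x.2) elem_val (plist p) k -
     p%:R ^+ n * \prod_(k <- x.2) - (bernoulli (p - k.+1) / k.+1%:R))).
case=> [x /(allP tP)/and3P[x0 xo /eqP xn] _|N NP].
  have := prod_elem_bernoulli x0 xo; rewrite xn.
  by apply: large_primesI (large_primes_pint x.1) => p pp h k; exact: pdvdMl.
have [M MP] := tdvd.
have [p [pp + pB]] := tB (maxn N M); rewrite gtn_max => /andP[Np Mp].
case/negP: pB; rewrite -[p]expn1; apply: pdvd_coprime_num => //.
apply: (@pdvd_pfactor p n) => //; rewrite addn1.
(* The [p ^ 1] in the Bernoulli index is a by-product of writing the divisor p as a power. *)
have -> : p%:R ^+ n * \sum_(x <- t) x.1 * \prod_(k <- x.2) - (bernoulli (p ^ 1 - k.+1) / k.+1%:R) =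
  Sval p (\sum_(x <- t) x.1 *: \prod_(k <- x.2) elem k) -
  \sum_(x <- t) x.1 * (\prod_(k <- x.2) elem_val (plist p) k -
     p%:R ^+ n * \prod_(k <- x.2) - (bernoulli (p - k.+1) / k.+1%:R)).
  rewrite Sval_monomial big_distrr -sumrB /= expn1; apply: eq_bigr => x _.
  by ring.
by apply: (pdvdB pp); [exact: MP | exact: NP].
Qed.

(** Induction on n. The correction h removes the monomials with an odd index from component n of f -
    g and leaves lower components alone; the remaining monomials are handled by [even_part_eq0]. *)
Lemma ker_approx f : bernoulli_conjecture -> in_ker f ->
  forall n, exists2 g, I_beta g & forall m, (m < n)%N -> g m = f m.
Proof.
move=> BC fK; elim=> [|n [g gI gf]]; first by exists 0 => //; exact: I_beta0.
have [s sP dE] := compP (f - g) n.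
have [h [hI hlt hn]] := reduce_odd sP.
exists (g + h); first exact: I_betaD.
have fghlt m : (m < n)%N -> (f - (g + h)) m = 0.
  by move=> mn; rewrite compD compN compD gf // hlt // addr0 subrr.
have fghn : (f - (g + h)) n =
    \sum_(x <- s | ~~ has odd x.2) x.1 *: \prod_(k <- x.2) elem k.
  rewrite opprD addrA compD compN hn dE (bigID (fun x => has odd x.2)) /=.
  by rewrite addrAC subrr add0r.
have fghK : in_ker (f - (g + h)).
  by apply: in_kerD => //; apply/in_kerN/in_kerD; exact: in_ker_I_beta.
have E0 : (f - (g + h)) n = 0.
  rewrite fghn; apply: (even_part_eq0 BC sP); rewrite -fghn.
  (* Components below n vanish, so level n + 1 of the kernel condition bears on component n alone
     and gives one factor p more than its H-degree does. *)
  apply: large_primesW (fghK n.+1) => p pp.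
  rewrite trunc_hatS (_ : trunc_hat n _ = 0) ?add0r //.
  by rewrite /trunc_hat big1 // => m _; exact: fghlt.
move=> m; rewrite ltnS leq_eqVlt => /predU1P[->|/fghlt].
  by move/eqP: E0; rewrite compD compN subr_eq0 => /eqP.
by move/eqP; rewrite compD compN subr_eq0 => /eqP.
Qed.

Theorem theorem6p1 :
  bernoulli_conjecture -> ker_Zhat = closure I_beta.
Proof.
move=> BC; apply/seteqP; split; last exact: closure_sub_ker.
move=> f /ker_ZhatP fK B [n _ nB].
have [g gI gf] := ker_approx BC fK n.
by exists g; split => //; exact: nB.
Qed.
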